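(* Let $X$ and $Y$ be Finsler manifolds with $Y$ connected, and let $f:X\to Y$ be a $C^1$ Fredholm map of index zero. Let $\mu(x)$ denote either of the two numbers $\operatorname{Inj} df(x)$ or $\operatorname{Sur} df(x)$ (the statement holds for either choice). Suppose that $f$ satisfies the Earle-Eells condition: $X$ is complete, and for every $y\in Y$ there exist $\alpha>0$ and a neighborhood $V$ of $y$ such that $\mu(x)\ge\alpha$ for all $x\in f^{-1}(V)$. Then $f$ is a smooth covering map.
   Context: Manifolds are nonempty, paracompact, real Banach manifolds, at least $C^1$, without boundary. A Finsler manifold (in the sense of Palais) is a manifold $X$ modeled on a Banach space $(E,|\cdot|)$ with a continuous map $\|\cdot\|_X:TX\to[0,\infty)$ such that (1) for every $x\in X$, $v\mapsto\|v\|_x:=\|(x,v)\|_X$ is a norm on $T_xX$ which in every chart at $x$ is equivalent to $|\cdot|$; (2) for every $x_0\in X$ and $k>1$ there is a chart $(W,\varphi)$ at $x_0$ such that for all $x\in W$, $w\in E$, $k^{-1}\|v_{x_0}(w)\|_{x_0}\le\|v_x(w)\|_x\le k\|v_{x_0}(w)\|_{x_0}$, where $v_x(w)=d(\varphi^{-1})(\varphi(x))w$. For connected $X$, $d_X(x,x')$ is the infimum of lengths $\int\|\dot\alpha(t)\|dt$ of $C^1$ paths joining $x$ to $x'$; $X$ is complete if $(X,d_X)$ is complete (if $X$ is not connected: each component is complete for its own Finsler metric). A $C^1$ map $f$ is Fredholm of index zero if for every $x\in X$, $df(x):T_xX\to T_{f(x)}Y$ has finite-dimensional kernel and cokernel of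 equal dimension. With $y=f(x)$: $\operatorname{Inj} df(x)=\inf_{\|v\|_x=1}\|df(x)v\|_y$ and $\operatorname{Sur} df(x)=\inf\{\|df(x)^*v^*\|_x: v^*\in(T_yY)^*,\ \|v^*\|_y=1\}$ (dual norms). A smooth covering map is a $C^1$ map $f:X\to Y$ that is onto and such that each $y\in Y$ has an open neighborhood $V$ for which $f^{-1}(V)$ is the union of a disjoint family of open subsets of $X$, each mapped diffeomorphically (of class $C^1$) onto $V$ by $f$. *)

(* Defs.v *)
(* MathComp-Analysis; scalars range over an arbitrary [R : realType]. *)
From HB Require Import structures.
From mathcomp Require Import all_boot all_order all_algebra.
From mathcomp Require Import all_classical all_reals all_analysis.

Set Implicit Arguments.
Unset Strict Implicit.
Unset Printing Implicit Defensive.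
Import Order.TTheory GRing.Theory Num.Theory.
Import numFieldNormedType.Exports.

Local Open Scope classical_set_scope.
Local Open Scope ring_scope.

Definition locally_finite (X : topologicalType) (V : set (set X)) : Prop :=
  forall x : X, exists2 N, nbhs x N & finite_set (V `&` [set A | A `&` N !=set0]).

(* As usual, paracompact spaces are required to be Hausdorff. *)
Definition paracompact (X : topologicalType) : Prop :=
  hausdorff_space X /\
  forall U : set (set X), (forall A, U A -> open A) ->
    \bigcup_(A in U) A = setT ->
    exists V : set (set X),
      [/\ (forall B, V B -> open B), \bigcup_(B in V) B = setT,
          (forall B, V B -> exists2 A, U A & B `<=` A) & locally_finite V].

(* The second clause is continuity of [fun x => 'd g x] for the operator norm.
   Only used for open [U]. *)
Definition C1_on (R : realType) (E F : normedModType R) (U : set E)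
    (g : E -> F) : Prop :=
  forall x, U x -> differentiable g x /\
    forall e : R, 0 < e ->
      \forall y \near x, forall h, `|'d g y h - 'd g x h| <= e * `|h|.

(* [cfun] and [cinv] carry no information outside [cdom] and [cimg]. *)
Record chart (R : realType) (E : normedModType R) (X : topologicalType) :=
  Chart {
    cdom : set X;
    cfun :> X -> E;
    cinv : E -> X;
    cdom_open : open cdom;
    cimg_open : open (cfun @` cdom);
    cfunK : forall x, cdom x -> cinv (cfun x) = x;
    cfun_continuous : forall x, cdom x -> {for x, continuous cfun};
    cinv_continuous : forall x, cdom x -> {for cfun x, continuous cinv} }.

Definition C1_transition (R : realType) (E : normedModType R)
    (X : topologicalType) (p q : chart E X) : Prop :=
  C1_on (p @` (cdom p `&` cdom q)) (q \o cinv p).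

(* A C^k manifold with k >= 1 is regarded here through its C^1 structure. *)
Record manifold (R : realType) (E : completeNormedModType R)
    (X : topologicalType) := Manifold {
  atlas : set (chart E X);
  atlas_cover : forall x, exists2 p, atlas p & cdom p x;
  atlas_C1 : forall p q, atlas p -> atlas q -> C1_transition p q;
  manifold_nonempty : [set: X] !=set0;
  manifold_paracompact : paracompact X }.

(* The tangent space at x is the model space, a tangent vector being identified
   with its coordinates in a chart [chart0 M x] of the atlas fixed once and for
   all for each x. *)
Definition tangent (R : realType) (E : completeNormedModType R)
    (X : topologicalType) (M : manifold E X) (x : X)
    : completeNormedModType R := E.

Section Manifold.
Context {R : realType} {E : completeNormedModType R} {X : topologicalType}.
Variable M : manifold E X.

(* "A chart of M" means a chart of the maximal atlas. *)
Definition chart_of (p : chart E X) : Prop :=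
  forall q, atlas M q -> C1_transition p q /\ C1_transition q p.

Definition chart_at (x : X) (p : chart E X) : Prop := chart_of p /\ cdom p x.

Definition chart0 (x : X) : chart E X := s2val (cid2 (atlas_cover M x)).

(* d(p^-1)(p x) w : the tangent vector at x with coordinates w in the chart p. *)
Definition tvec (p : chart E X) (x : X) (w : E) : tangent M x :=
  'd (chart0 x \o cinv p) (p x) w.

(* The topology of the tangent bundle is the one for which the maps
   (x, w) |-> (x, tvec p x w) are homeomorphisms of cdom p * E onto open sets;
   [fnorm_continuous] is continuity of the norm for this topology. *)
Record finsler := Finsler {
  fnorm : forall x, tangent M x -> R;
  fnorm_ge0 : forall x (v : tangent M x), 0 <= fnorm v;
  fnorm0_eq0 : forall x (v : tangent M x), fnorm v = 0 -> v = 0;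
  fnormZ : forall x (a : R) (v : tangent M x), fnorm (a *: v) = `|a| * fnorm v;
  fnormD : forall x (v w : tangent M x), fnorm (v + w) <= fnorm v + fnorm w;
  fnorm_continuous : forall p, chart_of p -> forall x w, cdom p x ->
    {for (x, w), continuous (fun z : X * E => fnorm (tvec p z.1 z.2))};
  fnorm_equiv : forall x p, chart_at x p ->
    exists c C : R, [/\ 0 < c, 0 < C & forall w : E,
      c * `|w| <= fnorm (tvec p x w) <= C * `|w|];
  fnorm_chart : forall (x0 : X) (k : R), 1 < k ->
    exists2 p, chart_at x0 p & forall x (w : E), cdom p x ->
      k^-1 * fnorm (tvec p x0 w) <= fnorm (tvec p x w)
        <= k * fnorm (tvec p x0 w) }.

(* C^1 paths on [0, 1]; C^1 on the compact interval means, as usual, having a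
   C^1 extension to an open neighbourhood of it. *)
Definition C1_path (a : R -> X) : Prop :=
  exists U : set R, [/\ open U, `[0, 1] `<=` U,
    forall t, U t -> {for t, continuous a} &
    forall p, atlas M p ->
      C1_on (U `&` a @^-1` cdom p : set R^o) (p \o a : R^o -> E)].

Definition velocity (a : R -> X) (t : R) : tangent M (a t) :=
  derive1 (chart0 (a t) \o a) t.

Variable N : finsler.

Definition path_length (a : R -> X) : \bar R :=
  (\int[lebesgue_measure]_(t in `[0%R, 1%R]) (fnorm N (velocity a t))%:E)%E.

(* Finite exactly when x and x' lie in the same component, where it is the
   Finsler metric of that component. *)
Definition finsler_dist (x x' : X) : \bar R :=
  ereal_inf [set path_length a | a in
    [set a | [/\ C1_path a, a 0 = x & a 1 = x']]].

Definition finsler_complete : Prop :=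
  forall (x0 : X) (u : nat -> X),
    (forall n, connected_component setT x0 (u n)) ->
    (forall e : R, 0 < e -> exists n0, forall m n, (n0 <= m)%N -> (n0 <= n)%N ->
       (finsler_dist (u m) (u n) < e%:E)%E) ->
    exists2 l, connected_component setT x0 l &
      finsler_dist (u n) l @[n --> \oo] --> 0%E.

(* Norm on the dual of the tangent space at x. *)
Definition dual_norm (x : X) (l : tangent M x -> R) : \bar R :=
  ereal_sup [set `|l v|%:E | v in [set v : tangent M x | fnorm N v <= 1]].

End Manifold.

(* For subspaces B <= A of V, dim (A / B) = n: the classes of the n vectors b
   form a basis of A / B. *)
Definition quotient_dim (R : realType) (V : lmodType R) (A B : set V) (n : nat)
    : Prop :=
  exists b : 'I_n -> V, (forall i, A (b i)) /\
    forall v, A v -> exists! a : 'rV[R]_n, B (v - \sum_i a 0 i *: b i).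

Definition fredholm_index0 (R : realType) (V W : lmodType R)
    (T : {linear V -> W}) : Prop :=
  exists n, quotient_dim [set v | T v = 0] [set 0] n /\
            quotient_dim setT (range T) n.

Section Maps.
Context {R : realType} {E F : completeNormedModType R} {X Y : topologicalType}.
Variables (MX : manifold E X) (MY : manifold F Y).

(* Only used for open [U]. *)
Definition C1_map_on (U : set X) (f : X -> Y) : Prop :=
  (forall x, U x -> {for x, continuous f}) /\
  forall p q, atlas MX p -> atlas MY q ->
    C1_on (p @` (U `&` cdom p `&` f @^-1` cdom q)) (q \o f \o cinv p).

Definition C1_map (f : X -> Y) : Prop := C1_map_on setT f.

Definition tdiff (f : X -> Y) (x : X) :
    {linear tangent MX x -> tangent MY (f x)} :=
  'd (chart0 MY (f x) \o f \o cinv (chart0 MX x)) (chart0 MX x x).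

Definition C1_fredholm0 (f : X -> Y) : Prop :=
  C1_map f /\ forall x, fredholm_index0 (tdiff f x).

Variables (NX : finsler MX) (NY : finsler MY).

(* The infima are taken in \bar R, so that they are +oo when the unit sphere
   is empty (zero-dimensional tangent spaces). *)
Definition Inj_diff (f : X -> Y) (x : X) : \bar R :=
  ereal_inf [set (fnorm NY (tdiff f x v))%:E | v in
    [set v : tangent MX x | fnorm NX v = 1]].

Definition Sur_diff (f : X -> Y) (x : X) : \bar R :=
  ereal_inf [set dual_norm NX (l \o tdiff f x) | l in
    [set l : {linear tangent MY (f x) -> R^o} |
      continuous l /\ dual_norm NY l = 1%E]].

Definition earle_eells (f : X -> Y) (mu : X -> \bar R) : Prop :=
  finsler_complete NX /\
  forall y : Y, exists2 alpha : R, 0 < alpha &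
    exists2 V, nbhs y V & forall x, V (f x) -> (alpha%:E <= mu x)%E.

End Maps.

Section Covering.
Context {R : realType} {E F : completeNormedModType R} {X Y : topologicalType}.
Variables (MX : manifold E X) (MY : manifold F Y).

(* f restricts to a C^1 diffeomorphism, with inverse g, from the open set U
   onto the open set V. *)
Definition diffeo_onto (f : X -> Y) (U : set X) (V : set Y) : Prop :=
  f @` U = V /\ C1_map_on MX MY U f /\
  exists g : Y -> X, (forall x, U x -> g (f x) = x) /\ C1_map_on MY MX V g.

Definition smooth_covering (f : X -> Y) : Prop :=
  [/\ C1_map MX MY f, range f = setT &
    forall y, exists V : set Y, [/\ open V, V y &
      exists D : set (set X),
        [/\ f @^-1` V = \bigcup_(U in D) U, trivIset D id &
          forall U, D U -> open U /\ diffeo_onto f U V]]].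

End Covering.

(* Main.v *)
(* The lower bound on mu makes every df(x) an isomorphism with
   ||df(x)^-1|| <= C locally uniformly in f(x): for Inj because the index is zero,
   for Sur by Hahn-Banach and a geometric series.  Hence f is a local
   diffeomorphism, and any continuous section of f is C^1.  Over a chart ball B on
   which the bound is uniform, lift segments starting at w0: as long as it exists,
   the lift of a segment has bounded speed, so it is Cauchy for the Finsler
   distance and converges by completeness, and a local section at the limit point
   prolongs it.  Prolonging sections over thin convex neighbourhoods of segments,
   rather than mere lifts of segments, yields a section over all of B through
   each point of the fibres.  The images of these sections are the sheets over B,
   and the image of f is open and closed. *)
Require Import Defs.
From HB Require Import structures.
From mathcomp Require Import all_boot all_order all_algebra.
From mathcomp Require Import all_classical all_reals all_analysis.
From mathcomp Require Import measurable_realfun lra ring.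
Set Implicit Arguments.
Unset Strict Implicit.
Unset Printing Implicit Defensive.
Import Order.TTheory GRing.Theory Num.Theory.
Import numFieldNormedType.Exports.
Local Open Scope classical_set_scope.
Local Open Scope ring_scope.

(** * Sublinear functionals *)

(** Completeness speaks of lengths of C^1 paths, whereas prolonging a section needs a limit in the
    topology of [X]. The bridge is that a short path ending at [x] must start near [x]. Balls of [E]
    are not compact, so this fact itself uses completeness of [E], to control a path at the moment
    when it might leave a chart. The paths constructed are all lifts of single segments,
    reparametrised affinely, so that nothing has to be concatenated or smoothed. Convexity removes
    the gluing problem: two convex domains containing [w0] meet in a convex, hence connected, set,
    so that their sections agree there, and continuity of the lift in the endpoint comes with the
    section instead of needing a separate argument. *)

Definition sublinear (R : realType) (V : lmodType R) (q : V -> R) : Prop :=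
  (forall x y, q (x + y) <= q x + q y) /\
  (forall (a : R) x, 0 < a -> q (a *: x) <= a * q x).

Section HahnBanach.
Context {R : realType} {V : lmodType R}.
Implicit Types (p q : V -> R) (x y : V).

Lemma sublinear0 q : sublinear q -> q 0 = 0.
Proof.
move=> [_ qZ]; apply/eqP; rewrite eq_le.
have := qZ 2 0 ltac:(by []); have := qZ 2^-1 0 ltac:(by rewrite invr_gt0).
by rewrite !scaler0 => h1 h2; apply/andP; split; lra.
Qed.

(** The definition asks for one inequality at positive scalars only, which is easy to check for
    infima; the inverse scalar supplies the other one. *)
Lemma sublinearZ q (a : R) x : sublinear q -> 0 <= a -> q (a *: x) = a * q x.
Proof.
move=> sq; rewrite le_eqVlt => /orP[/eqP<-|a0].
  by rewrite scale0r mul0r sublinear0.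
apply/eqP; rewrite eq_le sq.2//= -ler_pdivlMl//.
by rewrite -{1}(scalerK (lt0r_neq0 a0) x) sq.2// invr_gt0.
Qed.

Lemma sublinear_ge q x : sublinear q -> - q (- x) <= q x.
Proof.
by move=> sq; have := sq.1 x (- x); rewrite subrr sublinear0// lerNl => ?; lra.
Qed.

(** The largest sublinear functional below [q] whose value at [- y] is at most [- q y]: the term
    [t = 0] gives the first bound, [t = 1] the second. *)
Definition sublinear_shift q y x : R :=
  inf [set q (x + t *: y) - t * q y | t in [set t | 0 <= t]].

Lemma sublinear_shift_le q y x t : sublinear q -> 0 <= t ->
  sublinear_shift q y x <= q (x + t *: y) - t * q y.
Proof.
move=> sq t0; apply: ge_inf; last by exists t.
(* The infimum is finite because [q (s *: y) <= q (x + s *: y) + q (- x)]. *)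
exists (- q (- x)) => _ [s /= s0 <-].
have := sq.1 (x + s *: y) (- x).
by rewrite addrAC subrr add0r sublinearZ// => h; lra.
Qed.

Lemma sublinear_shift_ge q y x b :
  (forall t, 0 <= t -> b <= q (x + t *: y) - t * q y) ->
  b <= sublinear_shift q y x.
Proof.
move=> h; apply: lb_le_inf; first by eexists; exists 0 => //=.
by move=> _ [t t0 <-]; exact: h.
Qed.

(** The terms with parameters [t] for [x1] and [s] for [x2] combine into the term with parameter
    [t + s]; a scalar [a] turns [t] into [a * t]. *)
Lemma sublinear_shiftP q y : sublinear q -> sublinear (sublinear_shift q y).
Proof.
move=> sq; split=> [x1 x2|a x a0].
  rewrite -lerBlDr; apply: sublinear_shift_ge => t t0.
  rewrite lerBlDr -lerBlDl; apply: sublinear_shift_ge => s s0.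
  rewrite lerBlDl; apply: (le_trans (sublinear_shift_le _ _ sq (addr_ge0 t0 s0))).
  have := sq.1 (x1 + t *: y) (x2 + s *: y).
  by rewrite addrACA scalerDl => h; lra.
rewrite -ler_pdivrMl//; apply: sublinear_shift_ge => t t0.
rewrite ler_pdivrMl//.
have at0 : 0 <= a * t by rewrite mulr_ge0 // ltW.
apply: (le_trans (sublinear_shift_le _ _ sq at0)).
by rewrite -scalerA -scalerDr sublinearZ ?(ltW a0)// mulrBr mulrA.
Qed.

(** Zorn's lemma for the reversed pointwise order. A nonempty chain is bounded by its pointwise
    infimum, which is finite since every sublinear functional below [p] is at least [- p (- x)] at
    [x]. *)
Lemma minimal_sublinear p : sublinear p ->
  exists q, [/\ sublinear q, forall x, q x <= p x &
    forall r, sublinear r -> (forall x, r x <= q x) -> r = q].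
Proof.
move=> sp.
pose T := {q : V -> R | sublinear q /\ forall x, q x <= p x}.
pose rel (s t : T) := `[< forall x, sval t x <= sval s x >].
have [||||[q [sq qp]] qmin] := @Zorn T rel.
- by move=> t; apply/asboolP.
- move=> r s t /asboolP rs /asboolP st; apply/asboolP => x.
  exact: le_trans (st x) (rs x).
- move=> [s hs] [t ht] /asboolP/= st /asboolP/= ts; apply: eq_exist.
  by apply/funext => x; apply/eqP; rewrite eq_le ts st.
- move=> A Atot.
  have [->|/set0P[a0 Aa0]] := eqVneq A set0; first by exists (exist _ p (conj sp (fun x => lexx (p x)))).
  pose m x := inf [set sval a x | a in A].
  have m_le x a : A a -> m x <= sval a x.
    move=> Aa; apply: ge_inf; last by exists a.
    exists (- p (- x)) => _ [[b [sb bp]] /= Ab <-].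
    by apply: le_trans (sublinear_ge _ sb); rewrite lerN2.
  have m_ge x b : (forall a, A a -> b <= sval a x) -> b <= m x.
    move=> h; apply: lb_le_inf; first by exists (sval a0 x), a0.
    by move=> _ [a Aa <-]; exact: h.
  have sm : sublinear m.
    split=> [x1 x2|a x apos].
      rewrite -lerBlDr; apply: (m_ge) => s As.
      rewrite lerBlDr -lerBlDl; apply: (m_ge) => t At; rewrite lerBlDl.
      have [/asboolP st|/asboolP ts] := Atot _ _ As At.
        apply: (le_trans (m_le _ _ At)); apply: (le_trans ((svalP t).1.1 _ _)).
        by rewrite lerD2r.
      apply: (le_trans (m_le _ _ As)); apply: (le_trans ((svalP s).1.1 _ _)).
      by rewrite lerD2l.
    rewrite -ler_pdivrMl//; apply: (m_ge) => s As; rewrite ler_pdivrMl//.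
    by apply: (le_trans (m_le _ _ As)); apply: (svalP s).1.2.
  have mp x : m x <= p x by apply: (le_trans (m_le _ _ Aa0)); apply: (svalP a0).2.
  by exists (exist _ m (conj sm mp)) => s As; apply/asboolP => x /=; exact: m_le.
exists q; split => // r sr rq.
have rp x : r x <= p x by exact: le_trans (rq x) (qp x).
have := qmin (exist _ r (conj sr rp)) _; move/(_ _)/(congr1 (@sval _ _)); apply.
by apply/asboolP => x /=.
Qed.

(* A minimal sublinear functional equals its own shift along each vector, which
   makes it odd, hence linear.  Minimizing below the shift of [p] along [y0],
   rather than below [p], forces [l y0 = p y0]. *)
Lemma hahn_banach p y0 : sublinear p ->
  exists l : {linear V -> R^o}, (forall x, l x <= p x) /\ l y0 = p y0.
Proof.
move=> sp.
have [q [sq qp qmin]] := minimal_sublinear (sublinear_shiftP y0 sp).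
have shift_le (r : V -> R) y x : sublinear r -> sublinear_shift r y x <= r x.
  move=> sr; apply: (le_trans (sublinear_shift_le y x sr (lexx 0))).
  by rewrite scale0r addr0 mul0r subr0.
have shiftN (r : V -> R) y : sublinear r -> sublinear_shift r y (- y) <= - r y.
  move=> sr; apply: (le_trans (sublinear_shift_le y (- y) sr ler01)).
  by rewrite scale1r addNr mul1r (sublinear0 sr) sub0r.
have qN y : q (- y) = - q y.
  apply/eqP; rewrite eq_le; apply/andP; split; last first.
    by rewrite lerNl; exact: sublinear_ge.
  by rewrite -{1}(qmin _ (sublinear_shiftP y sq)) ?shiftN// => x; exact: shift_le.
have qD x y : q (x + y) = q x + q y.
  apply/eqP; rewrite eq_le sq.1 /=.
  have := sq.1 (- x) (- y); rewrite -opprD !qN => h; lra.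
have qZ a x : q (a *: x) = a * q x.
  have [a0|a0] := leP 0 a; first exact: sublinearZ.
  rewrite -[a]opprK scaleNr qN sublinearZ ?oppr_ge0 ?(ltW a0)//.
  by rewrite -mulNr.
have qlin : linear (q : V -> R^o) by move=> a x y; rewrite qD qZ.
pose l : {linear V -> R^o} := HB.pack (q : V -> R^o)
  (GRing.isLinear.Build R V R^o *:%R (q : V -> R^o) qlin).
exists l; split=> [x|]; first exact: le_trans (qp x) (shift_le _ _ _ sp).
apply/eqP; rewrite eq_le; apply/andP; split.
  exact: le_trans (qp y0) (shift_le _ _ _ sp).
rewrite -lerN2 /= -(qN y0).
by apply: (le_trans (qp _)); exact: shiftN.
Qed.

End HahnBanach.

Lemma norming_functional (R : realType) (V : normedModType R) (v : V) :
  exists l : {linear V -> R^o}, (forall x, `|l x| <= `|x|) /\ l v = `|v|.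
Proof.
have sn : sublinear (fun x : V => `|x|).
  by split=> [x y|a x a0]; rewrite ?ler_normD// normrZ gtr0_norm.
have [l [lp lv]] := hahn_banach v sn; exists l; split=> // x.
by rewrite ler_norml lp andbT lerNl -linearN -[leRHS]normrN.
Qed.

(** * Strict differentiability *)

Section StrictDifferentiability.
Context {R : realType}.
Implicit Types E F G : normedModType R.

Lemma nbhs_distP E (x : E) (P : set E) :
  nbhs x P <-> exists2 d : R, 0 < d & forall y, `|y - x| < d -> P y.
Proof.
split=> [/nbhs_normP[d /= d0 dP]|[d d0 dP]].
  by exists d => // y yx; apply: dP; rewrite /= distrC.
by apply/nbhs_normP; exists d => //= y /= yx; apply: dP; rewrite distrC.
Qed.

(** Strict differentiability. At all points of an open set it amounts to being C^1 there, yet it is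
    a condition at one point, stable under composition and continuous inverses, with no topology on
    operators. *)
Definition sdiff E F (g : E -> F) (x : E) (T : {linear E -> F}) : Prop :=
  continuous T /\ forall e : R, 0 < e -> exists2 d : R, 0 < d &
    forall y z, `|y - x| < d -> `|z - x| < d ->
      `|g y - g z - T (y - z)| <= e * `|y - z|.

Lemma sdiff_differentiable E F (g : E -> F) x T :
  sdiff g x T -> differentiable g x /\ 'd g x = T :> (E -> F).
Proof.
move=> [cT gT].
have gx : g \o shift x = cst (g x) + T +o_ (0 : E) id.
  apply/eqaddoP => e e0; have [d d0 dP] := gT _ e0.
  apply/nbhs_distP; exists d => // y; rewrite subr0 => yd.
  have := dP (y + x) x; rewrite addrK subrr normr0 => /(_ yd d0).
  by rewrite !fctE /= opprD addrA.
have dg := diff_unique cT gx; split => //.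
by apply/diff_locallyP; rewrite dg.
Qed.

Lemma sdiff_diff E F (g : E -> F) x T v : sdiff g x T -> 'd g x v = T v.
Proof. by move=> /sdiff_differentiable[_ ->]. Qed.

Lemma sdiff_near E F (g h : E -> F) x T :
  (\forall y \near x, g y = h y) -> sdiff g x T -> sdiff h x T.
Proof.
move=> /nbhs_distP[d d0 gh] [cT gT]; split=> // e e0.
have [d' d'0 d'P] := gT _ e0; exists (Order.min d d').
  by rewrite lt_min d0.
by move=> y z; rewrite !lt_min => /andP[yd yd'] /andP[zd zd']; rewrite -!gh// d'P.
Qed.

Lemma sdiff_linear E F (T : {linear E -> F}) x : continuous T -> sdiff T x T.
Proof.
move=> cT; split=> // e e0; exists 1 => // y z _ _.
by rewrite -linearB subrr normr0 mulr_ge0// ltW.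
Qed.

Lemma sdiff_comp E F G (g : E -> F) (h : F -> G) x
    (T : {linear E -> F}) (S : {linear F -> G}) :
  sdiff g x T -> sdiff h (g x) S -> sdiff (h \o g) x (S \o T).
Proof.
move=> [cT gT] [cS hS].
have cST : continuous (S \o T) by move=> v; apply: continuous_comp; [exact: cT|exact: cS].
split=> // e e0.
have [kS kS0 SP] := linear_lipschitz cS.
have [kT kT0 TP] := linear_lipschitz cT.
(* Half of [e] is for the error of [g] magnified by [S], half for the error of [h] on increments of
   [g], whose Lipschitz constant near [x] is [kT + e1]. *)
pose e1 := e / 2 / kS; have e10 : 0 < e1 by rewrite !divr_gt0.
pose e2 := e / 2 / (kT + e1).
have e20 : 0 < e2 by rewrite !divr_gt0// addr_gt0.
have [d1 d10 d1P] := gT _ e10; have [d2 d20 d2P] := hS _ e20.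
have lip y z : `|y - x| < d1 -> `|z - x| < d1 ->
    `|g y - g z| <= (kT + e1) * `|y - z|.
  move=> yd zd; rewrite -[g y - g z](subrK (T (y - z))) mulrDl addrC.
  by rewrite (le_trans (ler_normD _ _))// lerD// d1P.
exists (Order.min d1 (d2 / (kT + e1))).
  by rewrite lt_min d10 divr_gt0// addr_gt0.
move=> y z; rewrite !lt_min => /andP[yd yd2] /andP[zd zd2] /=.
have gd w : `|w - x| < d1 -> `|w - x| < d2 / (kT + e1) -> `|g w - g x| < d2.
  move=> wd wd2; apply: le_lt_trans (lip _ _ wd _) _; first by rewrite subrr normr0.
  by rewrite mulrC -ltr_pdivlMr// addr_gt0.
have h2 := d2P _ _ (gd _ yd yd2) (gd _ zd zd2).
have h1 := d1P _ _ yd zd.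
rewrite -[h (g y) - h (g z)](subrK (S (g y - g z))) -addrA -linearB.
rewrite (le_trans (ler_normD _ _))// (splitr e) mulrDl lerD//.
  rewrite (le_trans h2)// /e2 -mulrA ler_pM2l ?divr_gt0//.
  by rewrite mulrC ler_pdivrMr ?addr_gt0// mulrC lip.
by rewrite (le_trans (SP _))// mulrC -ler_pdivlMr// mulrAC.
Qed.

Lemma is_derive_linear E (l : {linear E -> R^o}) (phi : R -> E) (t : R) v :
  continuous l -> is_derive t 1 phi v -> is_derive t 1 (l \o phi : R -> R) (l v).
Proof.
move=> cl [dphi Dphi].
have cvl : h^-1 *: ((l \o phi \o shift t) (h *: 1) - (l \o phi) t) @[h --> 0^'] --> l v.
  apply: (@cvg_trans _ ((l (h^-1 *: ((phi \o shift t) (h *: 1) - phi t))) @[h --> 0^'])).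
    apply: near_eq_cvg; near=> h.
    by rewrite linearZ linearB.
  by apply: continuous_cvg; [exact: cl|rewrite -Dphi; exact: dphi].
by split; [apply/cvg_ex; exists (l v)|exact: cvg_lim cvl].
Unshelve. all: by end_near. Qed.

(** A functional norming the increment reduces the estimate to the scalar mean value theorem. *)
Lemma mean_value_ineq E (phi dphi : R -> E) (a b K : R) : a <= b ->
  (forall t, a <= t <= b -> is_derive t 1 phi (dphi t)) ->
  (forall t, a <= t <= b -> `|dphi t| <= K) ->
  `|phi b - phi a| <= K * (b - a).
Proof.
move=> ab dP dK; have [l [lp lv]] := norming_functional (phi b - phi a).
have cl : continuous l.
  apply: bounded_linear_continuous; apply/linear_boundedP.
  exists 1; split=> // r r1 x; rewrite (le_trans (lp x))// ler_peMl// ltW//.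
have dl t : a <= t <= b -> is_derive t 1 (l \o phi : R -> R) (l (dphi t)).
  by move=> tab; apply: is_derive_linear => //; exact: dP.
have [||c cab] := @MVT_segment R (l \o phi) (l \o dphi) a b ab.
- by move=> t; rewrite in_itv /= => /andP[t1 t2]; apply: dl; rewrite !ltW.
- apply: continuous_in_subspaceT => t; rewrite inE /= in_itv /= => tab.
  apply: differentiable_continuous; apply/derivable1_diffP.
  exact: (@ex_derive _ _ _ _ _ _ _ (dl _ tab)).
rewrite /= -linearB lv => ->; rewrite ler_wpM2r ?subr_ge0//.
by rewrite (le_trans (ler_norm _))// (le_trans (lp _))// dK// -in_itv.
Qed.

Lemma is_derive_line E F (g : E -> F) (z w : E) (t : R) :
  differentiable g (z + t *: w) ->
  is_derive t 1 (fun s => g (z + s *: w)) ('d g (z + t *: w) w).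
Proof.
move=> dg.
pose L : R^o -> E := cst z + (( *:%R^~ w) : R^o -> E).
have dL : is_diff (t : R^o) L ( *:%R^~ w) by apply: is_diff_eq; rewrite add0r.
have dgL : differentiable (g \o L) t.
  by apply: differentiable_comp; [exact: ex_diff|exact: dg].
apply: (@DeriveDef _ _ _ t 1 (g \o L)); first exact: diff_derivable.
rewrite deriveE// diff_comp//=.
by rewrite diff_val scale1r.
Qed.

(** The mean value inequality is applied on the segment from [z] to [y] to [g] minus its
    differential at [x], whose derivative is small near [x] by continuity of the differential. *)
Lemma C1_on_sdiff E F (U : set E) (g : E -> F) x :
  open U -> C1_on U g -> U x -> sdiff g x ('d g x).
Proof.
move=> oU gU Ux; have [dgx gx] := gU _ Ux.
split=> [|e e0]; first exact: diff_continuous.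
have /nbhs_distP[d1 d10 d1P] := open_nbhs_nbhs (conj oU Ux).
have /nbhs_distP[d2 d20 d2P] := gx _ e0.
exists (Order.min d1 d2); first by rewrite lt_min d10.
move=> y z yd zd; set T := 'd g x.
pose phi (t : R) : F := g (z + t *: (y - z)) - t *: T (y - z).
pose dphi (t : R) : F := 'd g (z + t *: (y - z)) (y - z) - T (y - z).
have ball t : 0 <= t <= 1 -> `|z + t *: (y - z) - x| < Order.min d1 d2.
  move=> /andP[t0 t1].
  have -> : z + t *: (y - z) - x = t *: (y - x) + (1 - t) *: (z - x).
    have -> : y - z = (y - x) - (z - x) by rewrite opprB addrA subrK.
    by rewrite (scalerBr t (y - x)) scalerBl scale1r addrAC addrCA.
  rewrite (le_lt_trans (ler_normD _ _))// !normrZ ger0_norm// ger0_norm ?subr_ge0//.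
  have [->|tn0] := eqVneq t 0; first by rewrite mul0r add0r subr0 mul1r.
  have tp : 0 < t by rewrite lt_def tn0.
  have : t * `|y - x| < t * Order.min d1 d2 by rewrite ltr_pM2l.
  have : (1 - t) * `|z - x| <= (1 - t) * Order.min d1 d2.
    by rewrite ler_wpM2l// ?subr_ge0// ltW.
  lra.
have := @mean_value_ineq F phi dphi 0 1 (e * `|y - z|) ler01.
rewrite subr0 mulr1 /phi scale1r scale0r scale1r scale0r subr0 addr0 addrCA subrr addr0.
rewrite addrAC; apply=> t t01; have := ball _ t01; rewrite lt_min => /andP[bd1 bd2].
  apply: is_deriveB.
    by apply: is_derive_line; have [] := gU _ (d1P _ bd1).
  have dl : is_diff (t : R^o) (( *:%R^~ (T (y - z))) : R^o -> F) ( *:%R^~ (T (y - z))).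
    exact: is_diff_scalel.
  have df : differentiable (( *:%R^~ (T (y - z))) : R^o -> F) (t : R^o) by [].
  apply: DeriveDef; first exact: diff_derivable.
  by rewrite deriveE// diff_val scale1r.
exact: d2P.
Qed.

(** The differentials [S] at [y] and [T] at [x] approximate the same increment from [y] to
    [y + s *: h]: [T] with relative error [e], by strictness at [x], and [S] with an arbitrarily
    small one. *)
Lemma sdiff_C1_on E F (U : set E) (g : E -> F) : open U ->
  (forall x, U x -> exists T, sdiff g x T) -> C1_on U g.
Proof.
move=> oU gU x Ux; have [T gT] := gU _ Ux.
have [dg dgE] := sdiff_differentiable gT; split=> // e e0.
have /nbhs_distP[d1 d10 d1P] := open_nbhs_nbhs (conj oU Ux).
have [d2 d20 d2P] := gT.2 _ e0.
apply/nbhs_distP; exists (Order.min d1 d2); first by rewrite lt_min d10.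
move=> y; rewrite lt_min => /andP[yd1 yd2] h.
have [S gS] := gU _ (d1P _ yd1); rewrite (sdiff_diff _ gS) (sdiff_diff _ gT).
have [->|h0] := eqVneq h 0; first by rewrite !linear0 addr0 !normr0 mulr0.
have hp : 0 < `|h| by rewrite normr_gt0.
apply/ler_addgt0Pl => c c0.
have ch0 : 0 < c / `|h| by rewrite divr_gt0.
have [d3 d30 d3P] := gS.2 _ ch0.
(* Rescaling [h] keeps [y + s *: h] within [d2] of [x] and within [d3] of [y]; the factor 2 makes
   both inequalities strict. *)
pose s := Order.min (d2 - `|y - x|) d3 / (2 * `|h|).
have s0 : 0 < s by rewrite divr_gt0 ?mulr_gt0// lt_min subr_gt0 yd2.
have sh : `|s *: h| < Order.min (d2 - `|y - x|) d3.
  rewrite normrZ gtr0_norm// /s invfM mulrA divfK ?gt_eqF//.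
  by rewrite ltr_pdivrMr// mulr_natr mulr2n ltrDl lt_min subr_gt0 yd2.
move: sh; rewrite lt_min => /andP[sh2 sh3].
clearbody s.
have hy : y + s *: h - y = s *: h by rewrite addrAC subrr add0r.
have A1 : `|g (y + s *: h) - g y - T (s *: h)| <= e * `|s *: h|.
  rewrite -{2 3}hy; apply: d2P => //.
  rewrite addrAC (le_lt_trans (ler_normD _ _))//; lra.
have A2 : `|g (y + s *: h) - g y - S (s *: h)| <= c / `|h| * `|s *: h|.
  by rewrite -{2 3}hy; apply: d3P => //; rewrite ?hy// subrr normr0.
have : `|S (s *: h) - T (s *: h)| <= (c / `|h| + e) * `|s *: h|.
  rewrite mulrDl -[S _ - _](subrKA (g (y + s *: h) - g y)).
  by rewrite (le_trans (ler_normD _ _))// lerD// distrC.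
rewrite (linearZ_LR S) (linearZ_LR T) -scalerBr !normrZ (gtr0_norm s0) mulrCA ler_pM2l//.
by rewrite mulrDl divfK ?gt_eqF.
Qed.

Lemma sdiff_continuous E F (g : E -> F) x T :
  sdiff g x T -> {for x, continuous g}.
Proof. by move=> /sdiff_differentiable[/differentiable_continuous]. Qed.

End StrictDifferentiability.

(** * The inverse function theorem *)

Section InverseFunction.
Context {R : realType}.

Lemma continuous_distP (E F : normedModType R) (g : E -> F) x :
  {for x, continuous g} <-> forall e : R, 0 < e -> exists2 d : R, 0 < d &
    forall y, `|y - x| < d -> `|g y - g x| < e.
Proof.
split=> [/cvgrPdist_lt gx e /gx/nbhs_distP[d d0 dP]|gx].
  by exists d => // y /dP; rewrite distrC.
apply/cvgrPdist_lt => e /gx[d d0 dP]; apply/nbhs_distP; exists d => // y /dP.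
by rewrite distrC.
Qed.

(** The lower bound [Tc] makes [G] Lipschitz near [w], once the error of [g] is absorbed; the error
    of [G] is then, up to sign, [S] applied to that of [g]. *)
Lemma sdiff_inverse (E F : normedModType R) (g : E -> F) (G : F -> E) (w : F)
    (T : {linear E -> F}) (S : {linear F -> E}) (c : R) :
  0 < c -> (forall v, c * `|v| <= `|T v|) -> cancel S T -> cancel T S ->
  sdiff g (G w) T -> {for w, continuous G} ->
  (\forall u \near w, g (G u) = u) -> sdiff G w S.
Proof.
move=> c0 Tc SK TK [cT gT] cG gG.
have Sc u : `|S u| <= c^-1 * `|u| by rewrite ler_pdivlMl// -{2}[u]SK Tc.
split=> [|e e0].
  apply: bounded_linear_continuous; apply/linear_boundedP.
  exists c^-1; split=> [|r cr x]; first by rewrite realV gtr0_real.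
  by rewrite (le_trans (Sc x))// ler_wpM2r// ltW.
(* With [c / 2] the error is absorbed and [G] has Lipschitz constant [2 / c]; this and the bound
   [c^-1] for [S] turn [e * c * c / 2] into [e]. *)
pose e1 := Order.min (c / 2) (e * c * c / 2).
have e10 : 0 < e1 by rewrite lt_min !divr_gt0//= mulr_gt0// mulr_gt0.
have [d1 d10 d1P] := gT _ e10.
have /continuous_distP/(_ _ d10)[d2 d20 d2P] := cG.
have /nbhs_distP[d3 d30 d3P] := gG.
exists (Order.min d2 d3); first by rewrite lt_min d20.
move=> u v; rewrite !lt_min => /andP[u2 u3] /andP[v2 v3].
have := d1P (G u) (G v) (d2P _ u2) (d2P _ v2); rewrite !d3P//.
set D := G u - G v => h1.
have h2 : c * `|D| <= `|u - v| + e1 * `|D|.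
  rewrite (le_trans (Tc D))// -[T D](subrK (u - v)) addrC.
  by rewrite (le_trans (ler_normD _ _))// lerD2l distrC.
have e1c : e1 <= c / 2 by rewrite ge_min lexx.
have e1e : e1 <= e * c * c / 2 by rewrite ge_min lexx orbT.
have h3 : c / 2 * `|D| <= `|u - v|.
  have := ler_wpM2r (normr_ge0 D) e1c; lra.
rewrite -{1}(TK D) -linearB (le_trans (Sc _))// ler_pdivrMl// distrC.
rewrite (le_trans h1)//.
have := ler_wpM2r (normr_ge0 D) e1e.
have : e * c * (c / 2 * `|D|) <= e * c * `|u - v|.
  by rewrite ler_wpM2l// mulr_ge0// ltW.
lra.
Qed.

Lemma sdiff_expansive (E F : normedModType R) (g : E -> F) (x : E)
    (T : {linear E -> F}) (c : R) :
  0 < c -> (forall v, c * `|v| <= `|T v|) -> sdiff g x T ->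
  exists2 d : R, 0 < d & forall y z, `|y - x| < d -> `|z - x| < d ->
    `|g y - g z - T (y - z)| <= c / 2 * `|y - z| /\
    c / 2 * `|y - z| <= `|g y - g z|.
Proof.
move=> c0 Tc [_ gT]; have c20 : 0 < c / 2 by rewrite divr_gt0.
have [d d0 dP] := gT _ c20; exists d => // y z yd zd; split; first exact: dP.
have h1 := dP _ _ yd zd; have h2 := Tc (y - z).
have := ler_normD (g y - g z) (- (g y - g z - T (y - z))).
rewrite [X in `|X|](_ : _ = T (y - z)); last by rewrite opprB addrC subrK.
by rewrite normrN; lra.
Qed.

(** Newton's map with the fixed operator [S], namely [phi y = y - S (g y - w)], has ratio 1/2:
    strictness bounds the error of [g] by [c / 2], and [S] is bounded by [c^-1]. Its fixed point
    solves [g y = w]. *)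
Lemma inverse_function (E : completeNormedModType R) (F : normedModType R)
    (g : E -> F) (x : E) (T : {linear E -> F}) (S : {linear F -> E}) (c : R) :
  0 < c -> (forall v, c * `|v| <= `|T v|) -> cancel S T -> cancel T S ->
  sdiff g x T ->
  exists G : F -> E, exists2 r : R, 0 < r & G (g x) = x /\
    forall w, `|w - g x| < r -> g (G w) = w /\ {for w, continuous G}.
Proof.
move=> c0 Tc SK TK gT.
have [d d0 dP] := sdiff_expansive c0 Tc gT.
have Sc u : `|S u| <= c^-1 * `|u| by rewrite ler_pdivlMl// -{2}[u]SK Tc.
have c20 : 0 < c / 2 by rewrite divr_gt0.
(* With this radius [phi] moves the centre by at most [d / 4], and it halves distances, so it
   preserves the closed ball of radius [d / 2]. *)
pose r := c * d / 4; have r0 : 0 < r by rewrite divr_gt0// mulr_gt0.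
have solve w : `|w - g x| < r -> exists2 y, `|y - x| < d & g y = w.
  move=> wr; pose U := [set y : E | `|y - x| <= d / 2].
  pose phi y := y - S (g y - w).
  have Ud y : U y -> `|y - x| < d by rewrite /U /=; lra.
  have contr y z : U y -> U z -> `|phi y - phi z| <= 2^-1 * `|y - z|.
    move=> /Ud Uy /Ud Uz; have [h _] := dP _ _ Uy Uz.
    have -> : phi y - phi z = - S (g y - g z - T (y - z)).
      rewrite /phi opprD addrACA -opprD -(linearB S).
      have -> : g y - w - (g z - w) = g y - g z by rewrite opprB addrA subrK.
      by rewrite [in RHS](linearB S) /= TK opprB.
    rewrite normrN (le_trans (Sc _))// ler_pdivrMl// (le_trans h)//; lra.
  have fU : {homo phi : y / U y >-> U y}.
    move=> y Uy; have Ux : U x by rewrite /U /= subrr normr0 divr_ge0// ltW.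
    have h1 := contr _ _ Uy Ux.
    have h2 : `|phi x - x| <= d / 4.
      rewrite /phi addrAC subrr add0r normrN (le_trans (Sc _))// distrC.
      by rewrite ler_pdivrMl// (le_trans (ltW wr))// /r mulrA.
    rewrite /U /= -(subrKA (phi x)) (le_trans (ler_normD _ _))//.
    have := Uy; rewrite /U /=; lra.
  pose f : {fun U >-> U} := mkfun fU.
  have [|||y Uy yf] := @banach_fixed_point R E U f.
  - by exists 2^-1%:nng; split=> [|[y z] [/= Uy Uz]]; [rewrite /=; lra|exact: contr].
  - rewrite (_ : U = closed_ball_ (fun z : E => `|z|) x (d / 2)); first exact: closed_closed_ball_.
    by apply/seteqP; split=> z; rewrite /U /closed_ball_ /= distrC.
  - by exists x; rewrite /U /= subrr normr0 divr_ge0// ltW.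
  exists y; first exact: Ud.
  have yphi : y = y - S (g y - w) := yf.
  have : S (g y - w) = 0 by rewrite -[LHS](subKr y) -yphi subrr.
  by move=> /(congr1 T); rewrite SK linear0 => /subr0_eq.
pose G w := xget x [set y | `|y - x| < d /\ g y = w].
have GP w : `|w - g x| < r -> `|G w - x| < d /\ g (G w) = w.
  by move=> /solve[y yd gy]; rewrite /G; case: xgetP => [_ -> //|/(_ y)[]].
exists G, r => //; split.
  have [] := GP (g x); first by rewrite subrr normr0.
  move=> Gd gG; have := (dP (G (g x)) x Gd); rewrite subrr normr0 => /(_ d0)[_].
  rewrite gG subrr normr0 pmulr_rle0// normr_le0 subr_eq0 => /eqP; exact.
move=> w wr; split; first by have [] := GP _ wr.
apply/continuous_distP => e e0.
exists (Order.min (r - `|w - g x|) (c / 2 * e)).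
  by rewrite lt_min subr_gt0 wr mulr_gt0.
move=> u; rewrite lt_min => /andP[ur ue].
have ur' : `|u - g x| < r.
  have := ler_normD (u - w) (w - g x); rewrite subrKA; lra.
have [Gu gu] := GP _ ur'; have [Gw gw] := GP _ wr.
have [_ h] := dP _ _ Gu Gw; move: h; rewrite gu gw => h.
by rewrite -(ltr_pM2l c20) (le_lt_trans h).
Qed.

End InverseFunction.

(** * Expansive Fredholm operators *)

Section EquivalentNorms.
Context {R : realType}.

(** A Finsler norm on a tangent space as a plain function on the model space, so that operator
    estimates need no second normed structure. *)
Definition equiv_norm (E : normedModType R) (n : E -> R) : Prop :=
  [/\ forall v w, n (v + w) <= n v + n w, forall (a : R) v, n (a *: v) = `|a| * n v &
    exists c C : R, [/\ 0 < c, 0 < C & forall v, c * `|v| <= n v <= C * `|v|]].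

Lemma equiv_norm_ge0 (E : normedModType R) (n : E -> R) v :
  equiv_norm n -> 0 <= n v.
Proof.
move=> [_ _ [c [C [c0 _ h]]]]; have /andP[h1 _] := h v.
by apply: le_trans h1; rewrite mulr_ge0// ltW.
Qed.

Lemma equiv_norm0 (E : normedModType R) (n : E -> R) : equiv_norm n -> n 0 = 0.
Proof. by move=> [_ nZ _]; rewrite -(scale0r (0 : E)) nZ normr0 mul0r. Qed.

Lemma equiv_normN (E : normedModType R) (n : E -> R) v :
  equiv_norm n -> n (- v) = n v.
Proof. by move=> [_ nZ _]; rewrite -scaleN1r nZ normrN1 mul1r. Qed.

Lemma equiv_norm_eq0 (E : normedModType R) (n : E -> R) v :
  equiv_norm n -> n v <= 0 -> v = 0.
Proof.
move=> [_ nZ [c [C [c0 _ h]]]] v0; have /andP[h1 _] := h v.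
apply/eqP; rewrite -normr_le0 -(pmulr_rle0 _ c0); exact: le_trans v0.
Qed.

(** If combinations of vectors of [A] all lie in [B], then [0] has both the zero row and the
    all-ones row as coordinates, and uniqueness leaves only [n = 0]. *)
Lemma quotient_dim_trivial (V : lmodType R) (A B : set V) (n : nat) : A 0 ->
  (forall (b : 'I_n -> V) (a : 'rV[R]_n), (forall i, A (b i)) ->
    B (0 - \sum_i a 0 i *: b i)) ->
  quotient_dim A B n -> n = 0%N.
Proof.
case: n => // n A0 AB [b [Ab /(_ 0 A0)[a [_ aU]]]].
have := aU 0 (AB b 0 Ab); rewrite (aU (const_mx 1) (AB b _ Ab)).
by move=> /rowP/(_ ord0); rewrite !mxE => /eqP; rewrite oner_eq0.
Qed.

Lemma quotient_dim0 (V : lmodType R) (A B : set V) :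
  quotient_dim A B 0 -> A `<=` B.
Proof. by move=> [b [_ h]] v /h[a []]; rewrite big_ord0 subr0. Qed.

Lemma linear_inverse (V W : lmodType R) (T : {linear V -> W}) :
  injective T -> range T = setT -> exists S : {linear W -> V}, cancel S T /\ cancel T S.
Proof.
move=> Tinj Tsur.
have /choice[S SK] : forall w, exists v, T v = w.
  by move=> w; have : [set: W] w by []; rewrite -Tsur => -[v _ <-]; exists v.
have Slin : linear S by move=> a u v; apply: Tinj; rewrite linearP !SK.
pose L : {linear W -> V} := HB.pack S (GRing.isLinear.Build R W V *:%R S Slin).
by exists L; split=> [w|v]; [exact: SK|apply: Tinj; exact: SK].
Qed.

(** Kernel and cokernel share the number [n]: the trivial kernel forces [n = 0], and then the range
    is everything. *)
Lemma fredholm_injective (V W : lmodType R) (T : {linear V -> W}) :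
  fredholm_index0 T -> injective T ->
  exists S : {linear W -> V}, cancel S T /\ cancel T S.
Proof.
move=> [n [kT rT]] Tinj; apply: linear_inverse => //.
have kT0 v : T v = 0 -> v = 0 by rewrite -(linear0 T); exact: Tinj.
have n0 : n = 0%N.
  apply: quotient_dim_trivial kT => //=; rewrite ?linear0//.
  move=> b a Ab; rewrite sub0r big1 ?oppr0// => i _.
  by rewrite (kT0 _ (Ab i)) scaler0.
by rewrite -subTset; apply: quotient_dim0; rewrite -n0.
Qed.

Lemma fredholm_surjective (V W : lmodType R) (T : {linear V -> W}) :
  fredholm_index0 T -> range T = setT ->
  exists S : {linear W -> V}, cancel S T /\ cancel T S.
Proof.
move=> [n [kT rT]] Tsur; apply: linear_inverse => //.
have n0 : n = 0%N by apply: quotient_dim_trivial rT => // b a _; rewrite Tsur.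
move: kT; rewrite n0 => /quotient_dim0 kT0 v w /eqP.
by rewrite -subr_eq0 -linearB => /eqP/kT0/subr0_eq.
Qed.

(** [dual_norm] freed from the manifold; at a point the two are convertible, with [n] the Finsler
    norm there. *)
Definition dual_norm_for (E : normedModType R) (n : E -> R) (l : E -> R) : \bar R :=
  ereal_sup [set `|l v|%:E | v in [set v | n v <= 1]].

Lemma dual_norm_le (E : normedModType R) (n : E -> R) (l : E -> R) (K : R) :
  (forall v, n v <= 1 -> `|l v| <= K) -> (dual_norm_for n l <= K%:E)%E.
Proof. by move=> h; apply: ge_ereal_sup => _ [v nv <-]; rewrite lee_fin h. Qed.

Lemma dual_norm_ge (E : normedModType R) (n : E -> R) (l : E -> R) v :
  n v <= 1 -> (`|l v|%:E <= dual_norm_for n l)%E.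
Proof. by move=> nv; apply: ereal_sup_ubound; exists v. Qed.

Lemma dual_norm_bound (E : normedModType R) (n : E -> R) (l : {linear E -> R^o})
    (d : R) v : equiv_norm n -> dual_norm_for n l = d%:E -> `|l v| <= d * n v.
Proof.
move=> nn ld; have [nv0|nvp] := leP (n v) 0.
  rewrite (equiv_norm_eq0 nn nv0) linear0 normr0 mulr_ge0// ?equiv_norm_ge0//.
  rewrite -lee_fin -ld; apply: le_trans (dual_norm_ge _ (v := 0) _); first by rewrite lee_fin.
  by rewrite equiv_norm0.
have := @dual_norm_ge E n l ((n v)^-1 *: v); rewrite ld lee_fin linearZ normrM.
have [_ -> _] := nn; rewrite gtr0_norm ?invr_gt0// mulVf ?gt_eqF// => /(_ (lexx _)).
by rewrite ler_pdivrMl// mulrC.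
Qed.

Lemma equiv_norm_continuous (E : normedModType R) (n : E -> R)
    (l : {linear E -> R^o}) (k : R) : equiv_norm n ->
  (forall v, `|l v| <= k * n v) -> continuous l.
Proof.
move=> nn lk; have [_ _ [c [C [c0 C0 nC]]]] := nn.
apply: bounded_linear_continuous; apply/linear_boundedP.
exists (`|k| * C); split=> [|r Cr x]; first exact: num_real.
rewrite (le_trans (lk x))//.
have /andP[_ h] := nC x.
have h1 : k * n x <= `|k| * n x.
  by rewrite ler_wpM2r ?ler_norm// equiv_norm_ge0.
rewrite (le_trans h1)//.
have h2 : `|k| * n x <= `|k| * (C * `|x|) by rewrite ler_wpM2l.
by rewrite (le_trans h2)// mulrA ler_wpM2r// ltW.
Qed.

(* Hahn-Banach for the seminorm [p], the infimal convolution of [nE] and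
   [k * nF] along [T]: a functional dominated by [p] has dual norm at most [1]
   after composition with [T], hence dual norm at most [1 / al] itself. *)
Lemma dual_expansive_approx (E F : normedModType R) (nE : E -> R) (nF : F -> R)
    (T : {linear E -> F}) (al : R) :
  equiv_norm nE -> equiv_norm nF -> 0 < al ->
  (forall l : {linear F -> R^o}, continuous l -> dual_norm_for nF l = 1%E ->
    (al%:E <= dual_norm_for nE (l \o T))%E) ->
  forall y, exists v, nE v <= 2 / al * nF y /\ nF (y - T v) <= nF y / 2.
Proof.
move=> hE hF al0 hT y.
have [nED nEZ _] := hE; have [nFD nFZ _] := hF.
(* If the expression for [v] is below [2 / al * nF y], then so is [nE v], and as [k] is twice
   [2 / al] the remainder has at most half the norm of [y]. *)
pose k := 4 / al; have k0 : 0 < k by rewrite divr_gt0.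
pose p z := inf [set nE v + k * nF (z - T v) | v in setT].
have pos_nn u z : 0 <= nE u + k * nF z.
  by rewrite addr_ge0 ?(equiv_norm_ge0 _ hE)// mulr_ge0 ?(equiv_norm_ge0 _ hF)// ltW.
have p_le z v : p z <= nE v + k * nF (z - T v).
  apply: ge_inf; last by exists v.
  exists 0 => _ [w _ <-]; exact: pos_nn.
have p_ge z b : (forall v, b <= nE v + k * nF (z - T v)) -> b <= p z.
  move=> h; apply: lb_le_inf; first by exists (nE 0 + k * nF (z - T 0)), 0.
  by move=> _ [v _ <-].
have sp : sublinear p.
  split=> [z1 z2|a z a0].
    rewrite -lerBlDr; apply: (p_ge) => v1; rewrite lerBlDr -lerBlDl.
    apply: (p_ge) => v2; rewrite lerBlDl (le_trans (p_le _ (v1 + v2)))//.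
    have := nED v1 v2; have := nFD (z1 - T v1) (z2 - T v2).
    rewrite addrACA -opprD -linearD => h1 h2.
    have : k * nF (z1 + z2 - T (v1 + v2)) <= k * (nF (z1 - T v1) + nF (z2 - T v2)).
      by rewrite ler_pM2l.
    lra.
  rewrite -ler_pdivrMl//; apply: (p_ge) => v; rewrite ler_pdivrMl//.
  rewrite (le_trans (p_le _ (a *: v)))// linearZ -scalerBr nEZ nFZ gtr0_norm//.
  by rewrite mulrDr mulrCA.
have [l [lp ly]] := hahn_banach y sp.
have lk z : `|l z| <= k * nF z.
  have h u : l u <= k * nF u.
    apply: (le_trans (lp u)); rewrite (le_trans (p_le u 0))//.
    by rewrite equiv_norm0// linear0 subr0 add0r.
  by rewrite ler_norml h andbT lerNl -linearN (le_trans (h _))// equiv_normN.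
have lT v : `|l (T v)| <= nE v.
  have h u : l (T u) <= nE u.
    by rewrite (le_trans (lp _))// (le_trans (p_le _ u))// subrr equiv_norm0// mulr0 addr0.
  by rewrite ler_norml h andbT lerNl -!linearN (le_trans (h _))// equiv_normN.
have cl : continuous l by exact: equiv_norm_continuous lk.
have dk : (dual_norm_for nF l <= k%:E)%E.
  by apply: dual_norm_le => v nv; rewrite (le_trans (lk v))// ler_piMr// ltW.
have d0 : (0 <= dual_norm_for nF l)%E.
  by apply: le_trans (dual_norm_ge _ (v := 0) _); rewrite ?lee_fin// equiv_norm0.
have ldE : dual_norm_for nF l = (fine (dual_norm_for nF l))%:E.
  by rewrite fineK// ge0_fin_numE// (le_lt_trans dk)// ltry.
set d := fine _ in ldE.
have dge0 : 0 <= d by rewrite -lee_fin -ldE.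
have dal : al * d <= 1.
  have [->|dn0] := eqVneq d 0; first by rewrite mulr0.
  have dp : 0 < d by rewrite lt_def dn0.
  have llin : linear (fun z => d^-1 * l z : R^o).
    by move=> a u v; rewrite linearP mulrDr mulrCA.
  pose l' : {linear F -> R^o} := HB.pack (fun z => d^-1 * l z : R^o)
    (GRing.isLinear.Build R F R^o *:%R (fun z => d^-1 * l z : R^o) llin).
  have l'E z : l' z = d^-1 * l z by [].
  have cl' : continuous l'.
    apply: (@equiv_norm_continuous _ _ l' (d^-1 * k) hF) => v.
    by rewrite l'E normrM gtr0_norm ?invr_gt0// -mulrA ler_pM2l ?invr_gt0.
  have dl'1 : (dual_norm_for nF l' <= 1)%E.
    apply: dual_norm_le => v nv; rewrite l'E normrM gtr0_norm ?invr_gt0//.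
    by rewrite ler_pdivrMl// mulr1 (le_trans (dual_norm_bound _ hF ldE))// ler_piMr.
  have dl' : dual_norm_for nF l' = 1%E.
    apply/eqP; rewrite eq_le dl'1 /=.
    have : (dual_norm_for nF l <= d%:E * dual_norm_for nF l')%E.
      apply: ge_ereal_sup => _ [v nv <-].
      have -> : `|l v| = d * `|l' v|.
        by rewrite l'E normrM gtr0_norm ?invr_gt0// mulrA mulfV// mul1r.
      rewrite EFinM lee_pmul2l//; exact: dual_norm_ge.
    by rewrite ldE -{1}[d%:E]mule1 lee_pmul2l.
  have := hT l' cl' dl'; move/le_trans => /(_ d^-1%:E).
  rewrite lee_fin => h; rewrite -ler_pdivlMr// mul1r; apply: h.
  apply: dual_norm_le => v nv; rewrite [(_ \o _) v]l'E normrM gtr0_norm ?invr_gt0//.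
  by rewrite ler_piMr ?invr_ge0// (le_trans (lT v)).
have py : p y <= nF y / al.
  rewrite -ly (le_trans (ler_norm _))// (le_trans (dual_norm_bound _ hF ldE))//.
  rewrite ler_pdivlMr// mulrC mulrA ler_piMl// equiv_norm_ge0//.
have [ny0|nyp] := leP (nF y) 0.
  exists 0; rewrite linear0 subr0 (equiv_norm_eq0 hF ny0).
  by rewrite (equiv_norm0 hE) (equiv_norm0 hF) mulr0 mul0r.
(* The infimum need not be attained, so it is approached with a factor 2 to spare; the room is
   strict because [nF y] is positive here. *)
have py2 : p y < 2 / al * nF y.
  apply: le_lt_trans py _; rewrite mulrAC -mulrA ltr_pMl ?divr_gt0//.
  by rewrite ltr1n.
have [|_ [v _ <-] hv] := inf_lt _ py2.
  by exists (nE 0 + k * nF (y - T 0)), 0.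
have v0 := equiv_norm_ge0 v hE; have w0 := equiv_norm_ge0 (y - T v) hF.
exists v; split.
  by have := mulr_ge0 (ltW k0) w0; lra.
have : k * nF (y - T v) < k * (nF y / 2).
  have -> : k * (nF y / 2) = 2 / al * nF y by rewrite /k; field; rewrite gt_eqF.
  lra.
by rewrite ltr_pM2l// => /ltW.
Qed.

(** The approximate solution is applied to its own remainder [yn], which is halved each time. The
    corrections form a series converging by completeness of [E], of total size at most
    [2 * (2 / al) * nF y]. *)
Lemma dual_expansive (E : completeNormedModType R) (F : normedModType R)
    (nE : E -> R) (nF : F -> R) (T : {linear E -> F}) (al : R) :
  equiv_norm nE -> equiv_norm nF -> 0 < al -> continuous T ->
  (forall l : {linear F -> R^o}, continuous l -> dual_norm_for nF l = 1%E ->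
    (al%:E <= dual_norm_for nE (l \o T))%E) ->
  forall y, exists v, T v = y /\ nE v <= 4 / al * nF y.
Proof.
move=> hE hF al0 cT hT y.
have /choice[s sP] := dual_expansive_approx hE hF al0 hT.
have [nED _ [cE [CE [cE0 CE0 nEC]]]] := hE.
have [_ _ [cF [CF [cF0 CF0 nFC]]]] := hF.
pose yn n := iter n (fun z => z - T (s z)) y.
pose u n := s (yn n).
have ynS n : nF (yn n) <= nF y * 2^-1 ^+ n.
  elim: n => [|n ih]; first by rewrite expr0 mulr1.
  have [_ h] := sP (yn n); rewrite (le_trans h)// exprSr mulrA ler_pM2r//.
have nu n : nE (u n) <= 2 / al * nF y * 2^-1 ^+ n.
  have [h _] := sP (yn n); by rewrite (le_trans h)// -[leRHS]mulrA ler_wpM2l ?ynS ?divr_ge0 ?(ltW al0).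
have half1 : `|2^-1 : R| < 1 by rewrite gtr0_norm// invf_lt1// ltr1n.
have Tser m : T (series u m) = y - yn m.
  elim: m => [|n ih]; first by rewrite /series /= big_geq// linear0 subrr.
  rewrite /series /= big_nat_recr//= linearD /= ih /u.
  by rewrite [X in _ = _ - X]/(yn n - T (s (yn n))) opprB addrA addrAC.
have nser m : nE (series u m) <= 2 / al * nF y * (2 - 2 * 2^-1 ^+ m).
  elim: m => [|n ih].
    by rewrite /series /= big_geq// (equiv_norm0 hE) expr0 mulr1 subrr mulr0.
  rewrite /series /= big_nat_recr//= (le_trans (nED _ _))//.
  rewrite exprSr; have := nu n; move: ih; rewrite /series /=; lra.
have cu : cvgn (series u).
  apply: normed_cvg; apply: (@series_le_cvg _ _ (geometric (cE^-1 * (2 / al * nF y)) 2^-1)).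
  - by move=> n; exact: normr_ge0.
  - move=> n; rewrite /geometric /= mulr_ge0 ?exprn_ge0// mulr_ge0 ?invr_ge0 ?(ltW cE0)//.
    by rewrite mulr_ge0 ?(equiv_norm_ge0 _ hF)// divr_ge0// ltW.
  - move=> n; rewrite /geometric /= -[leRHS]mulrA ler_pdivlMl//.
    by have /andP[h _] := nEC (u n); rewrite (le_trans h).
  - exact: is_cvg_geometric_series.
exists (limn (series u)); split.
  have c1 : T (series u n) @[n --> \oo] --> T (limn (series u)).
    by apply: continuous_cvg cu; exact: cT.
  have c2 : T (series u n) @[n --> \oo] --> y.
    have g0 : geometric (cF^-1 * nF y) 2^-1 @ \oo --> 0 by exact: cvg_geometric.
    apply/cvgrPdist_lt => e e0; have /cvgrPdist_lt/(_ e e0) := g0.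
    apply: filterS => n; rewrite sub0r normrN Tser opprB addrC subrK => h.
    apply: le_lt_trans h; rewrite (le_trans _ (ler_norm _))//= -[leRHS]mulrA.
    by rewrite ler_pdivlMl//; have /andP[h _] := nFC (yn n); rewrite (le_trans h).
  exact: cvg_unique c1 c2.
have nF0 := equiv_norm_ge0 y hF.
apply/ler_addgt0Pr => e e0.
have eC : 0 < e / CE by rewrite divr_gt0.
have /cvgrPdist_lt/(_ _ eC)[N _ NP] := cu.
have := NP N (leqnn N); rewrite ltr_pdivlMr// mulrC => h.
have := nED (limn (series u) - series u N) (series u N); rewrite subrK => h1.
have /andP[_ h2] := nEC (limn (series u) - series u N).
have h3 := nser N.
have : 2 / al * nF y * (2 - 2 * 2^-1 ^+ N) <= 2 / al * nF y * 2.
  rewrite ler_wpM2l ?lerBlDr ?lerDl ?mulr_ge0 ?exprn_ge0 ?invr_ge0 ?(ltW al0)//.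
have -> : 4 / al * nF y = 2 / al * nF y * 2 by ring.
lra.
Qed.

(** Surjectivity and index zero make [T] bijective, so the controlled preimage of [T v] can only be
    [v]. *)
Lemma fredholm_dual_expansive (E F : completeNormedModType R)
    (nE : E -> R) (nF : F -> R) (T : {linear E -> F}) (al : R) :
  equiv_norm nE -> equiv_norm nF -> 0 < al -> continuous T -> fredholm_index0 T ->
  (forall l : {linear F -> R^o}, continuous l -> dual_norm_for nF l = 1%E ->
    (al%:E <= dual_norm_for nE (l \o T))%E) ->
  forall v, al / 4 * nE v <= nF (T v).
Proof.
move=> hE hF al0 cT fT hT v; have sol := dual_expansive hE hF al0 cT hT.
have [|S [SK TK]] := fredholm_surjective fT.
  by apply/seteqP; split=> // y _; have [w [<- _]] := sol y; exists w.
have [w [/(can_inj TK) -> h]] := sol (T v).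
by rewrite -ler_pdivlMl ?divr_gt0// invf_div.
Qed.

Lemma inj_expansive (E F : normedModType R) (nE : E -> R) (nF : F -> R)
    (T : {linear E -> F}) (al : R) : equiv_norm nE -> equiv_norm nF ->
  (forall v, nE v = 1 -> al <= nF (T v)) -> forall v, al * nE v <= nF (T v).
Proof.
move=> hE hF h v; have [nv|nv] := leP (nE v) 0.
  by rewrite (equiv_norm_eq0 hE nv) (equiv_norm0 hE) mulr0 (equiv_norm_ge0 _ hF).
have [_ nEZ _] := hE; have [_ nFZ _] := hF.
have := h ((nE v)^-1 *: v); rewrite linearZ nEZ nFZ gtr0_norm ?invr_gt0//.
by rewrite mulVf ?gt_eqF// => /(_ erefl); rewrite ler_pdivlMl// mulrC.
Qed.

End EquivalentNorms.

(** * Charts and local inverses *)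

Section Charts.
Context {R : realType} {E : completeNormedModType R} {X : topologicalType}.
Implicit Types p q : chart E X.

Lemma chart_nbhs p x : cdom p x -> nbhs x (cdom p).
Proof. by move=> px; apply: open_nbhs_nbhs; split => //; exact: cdom_open. Qed.

Lemma chart_img p w : (p @` cdom p) w -> cdom p (cinv p w) /\ p (cinv p w) = w.
Proof. by move=> [x px <-]; rewrite cfunK. Qed.

Lemma chart_img_nbhs p x : cdom p x -> \forall w \near p x, (p @` cdom p) w.
Proof.
move=> px; apply: open_nbhs_nbhs; split; first exact: cimg_open.
by exists x.
Qed.

Lemma chart_image_open p (U : set X) : open U -> U `<=` cdom p -> open (p @` U).
Proof.
move=> oU Up; rewrite openE => _ [x Ux <-]; rewrite /interior.
have pU : nbhs (cinv p (p x)) U.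
  by rewrite (cfunK (Up _ Ux)); exact: open_nbhs_nbhs.
have h : \forall w \near p x, U (cinv p w) := cinv_continuous (Up _ Ux) pU.
apply: filterS2 (chart_img_nbhs (Up _ Ux)) h => w /chart_img[_ pw] Uw.
by exists (cinv p w).
Qed.

Lemma chart_image_nbhs p x (U : set X) : cdom p x -> nbhs x U ->
  \forall w \near p x, cdom p (cinv p w) /\ U (cinv p w) /\ p (cinv p w) = w.
Proof.
move=> px xU; have pU : nbhs (cinv p (p x)) U by rewrite (cfunK px).
have h : \forall w \near p x, U (cinv p w) := cinv_continuous px pU.
by apply: filterS2 (chart_img_nbhs px) h => w /chart_img[].
Qed.

Lemma transition_sdiff p q x : C1_transition p q -> cdom p x -> cdom q x ->
  sdiff (q \o cinv p) (p x) ('d (q \o cinv p) (p x)).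
Proof.
move=> pq px qx; apply: C1_on_sdiff pq _; last by exists x.
by apply: chart_image_open; [apply: openI; exact: cdom_open|move=> y []].
Qed.

(** Stated for maps from any normed space, so that it serves paths and sections read in a chart
    alike. *)
Lemma chart_change_sdiff (G : normedModType R) (g : G -> X) p q (s : G)
    (T : {linear G -> E}) :
  {for s, continuous g} -> C1_transition p q -> cdom p (g s) -> cdom q (g s) ->
  sdiff (p \o g) s T ->
  sdiff (q \o g) s ('d (q \o cinv p) (p (g s)) \o T).
Proof.
move=> cg pq ps qs pT.
apply: (@sdiff_near _ _ _ ((q \o cinv p) \o (p \o g))).
  have h : \forall t \near s, cdom p (g t) := cg _ (chart_nbhs ps).
  apply: filterS h => t pt /=.
  by rewrite cfunK.
by apply: sdiff_comp => //; exact: transition_sdiff.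
Qed.

Variable M : manifold E X.

Lemma chart0_atlas x : atlas M (chart0 M x).
Proof. by rewrite /chart0; case: cid2. Qed.

Lemma chart0_dom x : cdom (chart0 M x) x.
Proof. by rewrite /chart0; case: cid2. Qed.

Lemma atlas_chart_of p : atlas M p -> chart_of M p.
Proof. by move=> pM q qM; split; apply: (atlas_C1 (m := M)). Qed.

(** The reference chart composed with its own inverse is the identity near the point; this turns
    Finsler bounds in charts into bounds on the model space. *)
Lemma tvec_chart0 x w : tvec M (chart0 M x) x w = w.
Proof.
rewrite /tvec; have sd : sdiff (@id E) (chart0 M x x) idfun.
  by apply: (@sdiff_linear _ _ _ idfun) => v; exact: cvg_id.
have := sdiff_near _ sd; move=> /(_ (chart0 M x \o cinv (chart0 M x)))/(_ _)/sdiff_diff->//.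
by apply: filterS (chart_img_nbhs (chart0_dom x)) => u /chart_img[].
Qed.

Lemma finsler_equiv_norm (N : finsler M) x : @equiv_norm R E (@fnorm _ _ _ _ N x).
Proof.
split; [exact: fnormD|exact: fnormZ|].
have xp : chart_at M x (chart0 M x).
  by split; [exact/atlas_chart_of/chart0_atlas|exact: chart0_dom].
have [c [C [c0 C0 h]]] := fnorm_equiv N xp.
by exists c, C; split=> // v; have := h v; rewrite tvec_chart0.
Qed.

End Charts.

(** * Continuous sections: local existence, regularity, uniqueness *)

Section LocalInverse.
Context {R : realType} {E F : completeNormedModType R} {X Y : topologicalType}.
Variables (MX : manifold E X) (MY : manifold F Y) (f : X -> Y).
Hypothesis fC1 : C1_map MX MY f.
Hypothesis fiso : forall x, exists2 c : R, 0 < c &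
  (forall v : E, c * `|v| <= `|tdiff MX MY f x v : F|) /\
  exists S : {linear F -> E}, cancel S (tdiff MX MY f x) /\ cancel (tdiff MX MY f x) S.

Let p x := chart0 MX x.
Let q x := chart0 MY (f x).

Lemma map_continuous (x : X) : {for x, continuous f}.
Proof. by have [h _] := fC1; exact: h. Qed.

Lemma tdiff_sdiff (x : X) : @sdiff R E F (q x \o f \o cinv (p x)) (p x x) (tdiff MX MY f x).
Proof.
have [_ h] := fC1; have px := chart0_dom MX x; have qx := chart0_dom MY (f x).
apply: C1_on_sdiff (h _ _ (chart0_atlas MX x) (chart0_atlas MY (f x))) _.
  apply: chart_image_open; last by move=> y [[]].
  rewrite setTI; rewrite openE => y [py qy]; apply: filterI; first exact: chart_nbhs.
  exact: (map_continuous (chart_nbhs qy)).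
by exists x => //; split.
Qed.

Lemma locally_injective (x : X) : exists2 O : set X, nbhs x O &
  forall x1 x2, O x1 -> O x2 -> f x1 = f x2 -> x1 = x2.
Proof.
have [c c0 [Tc _]] := fiso x.
have [d d0 dP] := sdiff_expansive c0 Tc (tdiff_sdiff x).
have px := chart0_dom MX x.
exists (cdom (p x) `&` [set x' | `|p x x' - p x x| < d]).
  apply: filterI; first exact: chart_nbhs.
  by have /cvgrPdist_lt/(_ _ d0) := cfun_continuous px; apply: filterS => y; rewrite distrC.
move=> x1 x2 [p1 d1] [p2 d2] f12; have [_] := dP _ _ d1 d2.
rewrite /= !cfunK// f12 subrr normr0 pmulr_rle0 ?divr_gt0// normr_le0 subr_eq0 => /eqP.
by move=> /(congr1 (cinv (p x))); rewrite !cfunK.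
Qed.

Lemma local_section (x : X) : exists2 V : set Y, nbhs (f x) V & exists s : Y -> X,
  s (f x) = x /\ forall y, V y -> f (s y) = y /\ {for y, continuous s}.
Proof.
have [c c0 [Tc [S [SK TK]]]] := fiso x.
have [G [r r0 [Gx GP]]] := inverse_function c0 Tc SK TK (tdiff_sdiff x).
have px := chart0_dom MX x; have qx := chart0_dom MY (f x).
rewrite /= cfunK// in Gx GP.
have [_ cGx] : (q x \o f \o cinv (p x)) (G (q x (f x))) = q x (f x) /\ {for q x (f x), continuous G}.
  by apply: GP; rewrite subrr normr0.
have fq : nbhs x (f @^-1` cdom (q x)) := map_continuous (chart_nbhs qx).
have := chart_image_nbhs px fq; rewrite -Gx => /cGx Om.
(* The last condition keeps [G] in the image of the source chart, and its image under [f] in the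
   target chart; elsewhere [cinv] carries no information. *)
exists (cdom (q x) `&` [set y | `|q x y - q x (f x)| < r] `&`
    q x @^-1` [set w | cdom (p x) (cinv (p x) (G w)) /\
      (f @^-1` cdom (q x)) (cinv (p x) (G w)) /\ p x (cinv (p x) (G w)) = G w]).
  apply: filterI; last exact: (cfun_continuous qx) Om.
  apply: filterI; first exact: chart_nbhs.
  by have /cvgrPdist_lt/(_ _ r0) := cfun_continuous qx; apply: filterS => y; rewrite distrC.
exists (cinv (p x) \o G \o q x); split; first by rewrite /= Gx cfunK.
move=> y [[qy yr] [pG [fG pGK]]]; have [Gy cG] := GP _ yr; split.
  by move: Gy => /(congr1 (cinv (q x))); rewrite /= !cfunK.
apply: continuous_comp; first exact: cfun_continuous.
apply: continuous_comp; first exact: cG.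
by rewrite -pGK; exact: cinv_continuous.
Qed.

(** A continuous section is a continuous local right inverse of [f], so the estimate for inverses
    applies to it directly. The equation for [D] is what later bounds the speed of lifts. *)
Lemma section_sdiff (r : chart F Y) (s : F -> X) (w : F) :
  chart_of MY r -> (r @` cdom r) w -> {for w, continuous s} ->
  (\forall u \near w, f (s u) = cinv r u) ->
  exists D : {linear F -> E}, sdiff (p (s w) \o s) w D /\
    forall v, tdiff MX MY f (s w) (D v) = tvec MY r (f (s w)) v.
Proof.
move=> rM rw cs fs; have [c c0 [Tc [S [SK TK]]]] := fiso (s w).
set x := s w; have fx : f x = cinv r w by exact: nbhs_singleton fs.
have [rfx rK] := chart_img rw; rewrite -fx in rfx rK.
have px := chart0_dom MX x; have qx := chart0_dom MY (f x).
(* The section is first read in the reference charts, in which [tdiff] is expressed; the transition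
   from [r] is composed at the end. *)
pose G := p x \o s \o r \o cinv (q x).
have Gx : G (q x (f x)) = p x x by rewrite /G /= (cfunK qx) rK.
have crq : {for q x (f x), continuous (r \o cinv (q x))}.
  apply: continuous_comp; first exact: cinv_continuous.
  by rewrite (cfunK qx); exact: cfun_continuous.
have crqE : (r \o cinv (q x)) (q x (f x)) = w by rewrite /= (cfunK qx).
have csrq : {for q x (f x), continuous (s \o (r \o cinv (q x)))}.
  by apply: continuous_comp => //; rewrite crqE.
have cG : {for q x (f x), continuous G}.
  apply: (@continuous_comp _ _ _ (s \o (r \o cinv (q x))) (p x)) => //.
  by rewrite /= (cfunK qx) rK; exact: cfun_continuous.
have GK : \forall u \near q x (f x), (q x \o f \o cinv (p x)) (G u) = u.
  have h1 : \forall u \near q x (f x), f (s (r (cinv (q x) u))) = cinv r (r (cinv (q x) u)).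
    have H : \forall u \near (r \o cinv (q x)) (q x (f x)), f (s u) = cinv r u.
      by rewrite crqE.
    exact: (crq _ H).
  have h2 : \forall u \near q x (f x), cdom (p x) (s (r (cinv (q x) u))).
    have H : nbhs ((s \o (r \o cinv (q x))) (q x (f x))) (cdom (p x)).
      by rewrite /= (cfunK qx) rK; exact: chart_nbhs.
    exact: (csrq _ H).
  have h3 := chart_image_nbhs qx (chart_nbhs rfx).
  near=> u; have [_ [ru qu]] : cdom (q x) (cinv (q x) u) /\ cdom r (cinv (q x) u) /\ q x (cinv (q x) u) = u by near: u.
  rewrite /G /= (cfunK (_ : cdom (p x) (s (r (cinv (q x) u))))); last by near: u.
  by rewrite (near h1 u)// cfunK.
have Gs := tdiff_sdiff x; rewrite -Gx in Gs.
have sG := sdiff_inverse c0 Tc SK TK Gs cG GK.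
have [rq _] := rM _ (chart0_atlas MY (f x)).
exists (S \o 'd (q x \o cinv r) (r (f x))); split; last by move=> v /=; rewrite SK.
have rqs := transition_sdiff rq rfx qx.
have := @sdiff_comp _ _ _ _ (q x \o cinv r) G (r (f x)) _ S rqs.
rewrite /= (cfunK rfx) => /(_ sG); rewrite rK; apply: sdiff_near.
have qn : nbhs (f x) (cdom (q x)) by exact: chart_nbhs.
have := chart_image_nbhs rfx qn; rewrite rK; apply: filterS => u [ru [qu rKu]].
by rewrite /G /= (cfunK qu) rKu.
Unshelve. all: by end_near. Qed.

Lemma section_C1 (V : set Y) (s : Y -> X) : open V ->
  (forall y, V y -> f (s y) = y) -> (forall y, V y -> {for y, continuous s}) ->
  C1_map_on MY MX V s.
Proof.
move=> oV fs cs; split=> // r t rM tM.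
apply: sdiff_C1_on.
  apply: chart_image_open; last by move=> y [[]].
  rewrite openE => y [[Vy ry] ty]; apply: filterI; last by apply: (cs _ Vy); exact: chart_nbhs.
  by apply: filterI; [exact: open_nbhs_nbhs|exact: chart_nbhs].
move=> _ [y [[Vy ry] ty] <-].
have csr : {for r y, continuous (s \o cinv r)}.
  by apply: continuous_comp; [exact: cinv_continuous|rewrite (cfunK ry); exact: cs].
have [|//||D [sD _]] := @section_sdiff r (s \o cinv r) (r y) (atlas_chart_of rM).
- by exists y.
- have yV : nbhs y V by exact: open_nbhs_nbhs.
  by apply: filterS (chart_image_nbhs ry yV) => u [_ [Vu _]] /=; rewrite fs.
have sy : (s \o cinv r) (r y) = s y by rewrite /= cfunK.
eexists; apply: (@chart_change_sdiff _ _ _ _ (s \o cinv r) _ t _ _ csr _ _ _ sD).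
- exact: (atlas_C1 (m := MX)) (chart0_atlas _ _) tM.
- exact: chart0_dom.
- by rewrite sy.
Qed.

(** Near [s y], both [x] and [s (f x)] lie in a set on which [f] is injective, and they have the
    same image, so [x] is in the image of [s]. *)
Lemma section_image_open (V : set Y) (s : Y -> X) : open V ->
  (forall y, V y -> f (s y) = y) -> (forall y, V y -> {for y, continuous s}) ->
  open (s @` V).
Proof.
move=> oV fs cs; rewrite openE => _ [y Vy <-]; rewrite /interior.
have [Q xO Oinj] := locally_injective (s y).
have yV : nbhs (f (s y)) V by rewrite fs//; exact: open_nbhs_nbhs.
have hV : nbhs (s y) (f @^-1` V) := map_continuous yV.
have h2 : nbhs (s y) (f @^-1` (s @^-1` Q)).
  have H : nbhs (f (s y)) (s @^-1` Q) by rewrite fs//; exact: (cs _ Vy _ xO).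
  exact: (map_continuous H).
apply: filterS3 xO hV h2 => x Ox Vx Osx.
by exists (f x) => //; apply: Oinj => //; rewrite fs.
Qed.

(** The agreement set is open by local injectivity of [f] and closed because [X] is Hausdorff. As
    [s] and [t] are controlled only on [C], it and its complement are thickened to open sets of [G]
    by conditions restricted to [C]. *)
Lemma section_unique (G : topologicalType) (h : G -> Y) (C : set G)
    (s t : G -> X) (w : G) : hausdorff_space X -> connected C ->
  (forall u, C u -> f (s u) = h u /\ {for u, continuous s}) ->
  (forall u, C u -> f (t u) = h u /\ {for u, continuous t}) ->
  C w -> s w = t w -> forall u, C u -> s u = t u.
Proof.
move=> hX cC sP tP Cw sw u Cu.
pose A := [set u : G | nbhs u [set v | C v -> s v = t v]].
have oA : open A.
  by rewrite openE => v; rewrite /A /= nbhsE => -[B [oB Bv] BS]; rewrite /interior nbhsE; exists B => // z Bz; rewrite /= nbhsE; exists B.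
have agree v : C v -> s v = t v -> A v.
  move=> Cv stv; have [Q vO Oinj] := locally_injective (s v).
  have h1 : \forall z \near v, Q (s z) := (sP _ Cv).2 _ vO.
  have h2 : \forall z \near v, Q (t z) by apply: ((tP _ Cv).2); rewrite -stv.
  rewrite /A /=.
  apply: filterS2 h1 h2 => z Oz Oz' Cz; apply: Oinj => //.
  by rewrite (proj1 (sP _ Cz)) (proj1 (tP _ Cz)).
pose B' := [set v : G | nbhs v [set z | C z -> s z <> t z]].
have oB' : open B'.
  by rewrite openE => v; rewrite /B' /= nbhsE => -[D [oD Dv] DS]; rewrite /interior nbhsE; exists D => // z Dz; rewrite /= nbhsE; exists D.
have disagree v : C v -> s v <> t v -> B' v.
  move=> Cv /eqP stv.
  move: hX; rewrite open_hausdorff => /(_ _ _ stv)[[U W] /= [sU tW] [oU oW UW]].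
  rewrite !inE in sU tW.
  have h1 : \forall z \near v, U (s z) := (sP _ Cv).2 _ (open_nbhs_nbhs (conj oU sU)).
  have h2 : \forall z \near v, W (t z) := (tP _ Cv).2 _ (open_nbhs_nbhs (conj oW tW)).
  rewrite /B' /=; apply: filterS2 h1 h2 => z Uz Wz Cz stz.
  have : (U `&` W) (s z) by split => //=; rewrite stz.
  by move/eqP: UW => ->.
have AC : C `&` A = C.
  apply: cC; first by exists w; split => //; exact: agree.
    by exists A.
  exists (~` B'); first by rewrite closedC.
  apply/seteqP; split=> v [Cv Av]; split => //.
    by move=> /nbhs_singleton/(_ Cv); apply; apply: (nbhs_singleton Av).
  by apply: agree => //; apply: contrapT => /(disagree _ Cv).
by have : C u by []; rewrite -{1}AC => -[_ /nbhs_singleton/(_ Cu)].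
Qed.

End LocalInverse.

(** * Lengths of paths *)

(* The parameter is typed in [R^o] so that all the differentials of a path are
   taken along syntactically the same filter. *)
Definition path_derivative (R : realType) (E : normedModType R) (g : R^o -> E)
  (s : R^o) : E := 'd g s (1 : R^o).

Lemma path_derivative_continuous (R : realType) (E : normedModType R)
    (W : set R^o) (g : R^o -> E) (t : R^o) : C1_on W g -> W t ->
  {for t, continuous (path_derivative g)}.
Proof.
move=> gW Wt; have [_ h] := gW _ Wt; apply/cvgrPdist_le => e e0.
have n1 : `|1 : R^o| = 1 :> R by exact: (@normr1 R).
have := h _ e0; apply: filterS => s /(_ (1 : R^o)).
by rewrite n1 mulr1 => hs; rewrite distrC.
Qed.

Section Paths.
Context {R : realType} {E : completeNormedModType R} {X : topologicalType}.
Variables (M : manifold E X) (N : finsler M).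
Implicit Types (a : R -> X) (U : set R) (p : chart E X).

(** [C1_path] with its open parameter set made explicit; for the lift of a line this set need not be
    an interval. *)
Definition C1_path_on U a : Prop := [/\ open U, forall t, U t -> {for t, continuous a} &
  forall p, atlas M p -> C1_on (U `&` a @^-1` cdom p : set R^o) (p \o a : R^o -> E)].

Lemma path_preimage_open U a p : C1_path_on U a -> open (U `&` a @^-1` cdom p).
Proof.
move=> [oU ca _]; rewrite openE => t [Ut pt]; apply: filterI.
  exact: open_nbhs_nbhs.
exact: (ca _ Ut _ (chart_nbhs pt)).
Qed.

Lemma path_sdiff U a p t : C1_path_on U a -> chart_of M p -> U t -> cdom p (a t) ->
  exists T, @sdiff R R^o E (p \o a) t T.
Proof.
move=> Ua pM Ut pt; have [oU ca Ca] := Ua; have p0t := chart0_dom M (a t).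
have sd : @sdiff R R^o E (chart0 M (a t) \o a) t ('d (chart0 M (a t) \o a : R^o -> E) t).
  apply: C1_on_sdiff (Ca _ (chart0_atlas M (a t))) _; last by split.
  exact: path_preimage_open Ua.
have [_ tr] := pM _ (chart0_atlas M (a t)).
eexists; exact: (@chart_change_sdiff R E X R^o a _ p t _ (ca _ Ut) tr p0t pt sd).
Qed.

Lemma path_chart_C1 U a p : C1_path_on U a -> chart_of M p ->
  C1_on (U `&` a @^-1` cdom p : set R^o) (p \o a : R^o -> E).
Proof.
move=> Ua pM; apply: sdiff_C1_on; first exact: path_preimage_open Ua.
by move=> t [Ut pt]; exact: (path_sdiff Ua pM Ut pt).
Qed.

Lemma velocity_chart a t p (T : {linear R^o -> E}) : chart_of M p -> cdom p (a t) ->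
  {for t, continuous a} -> @sdiff R R^o E (p \o a) t T ->
  velocity M a t = tvec M p (a t) (T 1).
Proof.
move=> pM pt ca sT; have [tr _] := pM _ (chart0_atlas M (a t)).
have sd := @chart_change_sdiff R E X R^o a p _ t T ca tr pt (chart0_dom M (a t)) sT.
have [df dfE] := sdiff_differentiable sd.
by rewrite /velocity derive1E' ?dfE.
Qed.

Lemma velocity_diff U a t p : C1_path_on U a -> chart_of M p -> U t -> cdom p (a t) ->
  velocity M a t = tvec M p (a t) (path_derivative (p \o a) t).
Proof.
move=> Ua pM Ut pt; have [T sT] := path_sdiff Ua pM Ut pt; have [_ ca _] := Ua.
by rewrite (velocity_chart pM pt (ca _ Ut) sT) /path_derivative (sdiff_diff _ sT).
Qed.

(** The coordinates of [velocity M a s] refer to a chart that may jump with [a s]. In the chart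
    fixed at [a t] the derivative is continuous, and continuity of the norm on the tangent bundle
    applies. *)
Lemma speed_continuous U a t : C1_path_on U a -> U t ->
  {for t, continuous (fun s => fnorm N (velocity M a s))}.
Proof.
move=> Ua Ut; have [oU ca _] := Ua.
set p := chart0 M (a t); have pt : cdom p (a t) := chart0_dom M (a t).
have pM : chart_of M p := atlas_chart_of (chart0_atlas M (a t)).
have cd : (fun s : R => path_derivative (p \o a) s) @ t --> path_derivative (p \o a) t.
  exact: (path_derivative_continuous (path_chart_C1 Ua pM) (conj Ut pt)).
have cpair : (a s, path_derivative (p \o a) s) @[s --> t] --> (a t, path_derivative (p \o a) t).
  by apply: cvg_pair => //; exact: ca.
have cf := @fnorm_continuous R E X M N p pM (a t) (path_derivative (p \o a) t) pt.
have c1 : fnorm N (tvec M p (a s) (path_derivative (p \o a) s)) @[s --> t] -->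
    fnorm N (tvec M p (a t) (path_derivative (p \o a) t)).
  exact: (cvg_comp _ _ cpair cf).
have near_dom : \forall s \near t, (U `&` a @^-1` cdom p) s.
  by apply: open_nbhs_nbhs; split; [exact: path_preimage_open Ua|split].
rewrite /prop_for /continuous_at (velocity_diff Ua pM Ut pt).
apply: cvg_trans c1; apply: near_eq_cvg.
by apply: filterS near_dom => s [Us ps]; rewrite (velocity_diff Ua pM Us ps).
Qed.

Lemma speed_within U a (b c : R) : C1_path_on U a -> `[b, c] `<=` U ->
  {within `[b, c], continuous (fun s => fnorm N (velocity M a s))}.
Proof.
move=> Ua bcU; apply: continuous_in_subspaceT => t; rewrite inE => tbc.
by apply: (speed_continuous Ua); exact: bcU.
Qed.

Lemma speed_measurable U a (b c : R) : C1_path_on U a -> `[b, c] `<=` U ->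
  measurable_fun (`[b, c] : set R) (fun s : R => fnorm N (velocity M a s)).
Proof.
move=> Ua bcU.
by apply: subspace_continuous_measurable_fun => //; exact: speed_within Ua bcU.
Qed.

Lemma path_length_le U a (K : R) : C1_path_on U a -> `[0, 1] `<=` U ->
  (forall t, 0 <= t <= 1 -> fnorm N (velocity M a t) <= K) ->
  (path_length N a <= K%:E)%E.
Proof.
move=> Ua U01 aK.
have K0 : 0 <= K.
  by apply: le_trans (aK 0 _); [exact: fnorm_ge0|rewrite lexx ler01].
apply: (@le_trans _ _ (\int[lebesgue_measure]_(t in `[0%R, 1%R]) (cst K%:E) t)%E).
  apply: ge0_le_integral => //.
  - by move=> t _; rewrite lee_fin fnorm_ge0.
  - by apply/measurable_EFinP; exact: speed_measurable Ua U01.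
rewrite integral_cst//= lebesgue_measure_itv /= lte_fin ltr01.
by rewrite -EFinB subr0 mule1.
Qed.

(** A functional norming the displacement makes it the integral of a scalar derivative, which is at
    most the speed divided by [c]. *)
Lemma chart_displacement_le U a p (c t L : R) : C1_path_on U a -> `[0, 1] `<=` U ->
  chart_of M p -> 0 <= t < 1 -> 0 < c ->
  (forall s, t <= s <= 1 -> cdom p (a s)) ->
  (forall x w, cdom p x -> c * `|w| <= fnorm N (tvec M p x w)) ->
  (path_length N a <= L%:E)%E -> c * `|p (a 1) - p (a t)| <= L.
Proof.
move=> Ua U01 pM /andP[t0 t1] c0 pd pc aL.
have [l [lp lv]] := norming_functional (p (a 1) - p (a t)).
have cl : continuous l.
  apply: bounded_linear_continuous; apply/linear_boundedP.
  by exists 1; split=> // r r1 x; rewrite (le_trans (lp x))// ler_peMl// ltW.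
have inU s : t <= s <= 1 -> U s.
  by move=> /andP[ts s1]; apply: U01; rewrite /= in_itv /= s1 (le_trans t0 ts).
pose v s := path_derivative (p \o a) s.
pose psi : R -> R := c \*: (l \o (p \o a) : R -> R).
have dpsi s : t <= s <= 1 -> is_derive s 1 psi (c * l (v s)).
  move=> ts; apply: is_deriveZ; apply: is_derive_linear => //.
  have [T sT] := path_sdiff Ua pM (inU _ ts) (pd _ ts).
  have [df _] := sdiff_differentiable sT.
  apply: DeriveDef; first exact: diff_derivable.
  by rewrite /path_derivative deriveE.
have cpsi s : t <= s <= 1 -> {for s, continuous psi}.
  move=> /dpsi h; apply: differentiable_continuous; apply/derivable1_diffP.
  exact: (@ex_derive _ _ _ _ _ _ _ h).
have cdpsi : {within `[t, 1], continuous (fun s => c * l (v s))}.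
  apply: continuous_in_subspaceT => s; rewrite inE /= in_itv /= => ts.
  have cv : v @ s --> v s.
    exact: (path_derivative_continuous (path_chart_C1 Ua pM) (conj (inU _ ts) (pd _ ts))).
  apply: cvgM; first exact: cvg_cst.
  by apply: continuous_cvg; [exact: cl|exact: cv].
have FTC : (\int[lebesgue_measure]_(s in `[t, 1%R]) (c * l (v s))%:E = (psi 1)%:E - (psi t)%:E)%E.
  apply: continuous_FTC2 => //.
    split=> [s||].
    - rewrite in_itv /= => /andP[ts s1].
      have /dpsi h : t <= s <= 1 by rewrite !ltW.
      exact: (@ex_derive _ _ _ _ _ _ _ h).
    - by apply: cvg_at_right_filter; apply: cpsi; rewrite lexx ltW.
    - by apply: cvg_at_left_filter; apply: cpsi; rewrite lexx ltW.
  move=> s; rewrite in_itv /= => /andP[ts s1].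
  have /dpsi h : t <= s <= 1 by rewrite !ltW.
  by rewrite derive1E derive_val.
have tU : `[t, 1] `<=` U by move=> s; rewrite /= in_itv /=; exact: inU.
have le1 : (\int[lebesgue_measure]_(s in `[t, 1%R]) (c * l (v s))%:E <=
    \int[lebesgue_measure]_(s in `[t, 1%R]) (fnorm N (velocity M a s))%:E)%E.
  apply: le_integral => //.
  - by apply: continuous_compact_integrable cdpsi; exact: segment_compact.
  - by apply: continuous_compact_integrable (speed_within Ua tU); exact: segment_compact.
  - move=> s; rewrite inE /= in_itv /= => ts; rewrite lee_fin.
    rewrite (velocity_diff Ua pM (inU _ ts) (pd _ ts)) (le_trans _ (pc _ _ (pd _ ts)))//.
    by rewrite ler_pM2l// (le_trans (ler_norm _))// lp.
have le2 : (\int[lebesgue_measure]_(s in `[t, 1%R]) (fnorm N (velocity M a s))%:E <=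
    path_length N a)%E.
  apply: ge0_subset_integral => //.
  - by apply/measurable_EFinP; exact: speed_measurable Ua U01.
  - by move=> s _; rewrite lee_fin fnorm_ge0.
  - by move=> s; rewrite /= !in_itv /= => /andP[ts ->]; rewrite (le_trans t0 ts).
have := le_trans le1 (le_trans le2 aL).
by rewrite FTC -EFinB lee_fin /psi /= -mulrBr -linearB lv.
Qed.

(** Followed backwards from [x], a path cannot leave the ball of radius [r] in the chart without
    spending length [c * r]. This turns convergence for [finsler_dist] into convergence in the
    topology. *)
Lemma small_length_close (x : X) (O : set X) : nbhs x O -> hausdorff_space X ->
  exists2 d : R, 0 < d & forall a, C1_path M a -> a 1 = x ->
    (path_length N a < d%:E)%E -> O (a 0).
Proof.
move=> xO hX.
have [p [pM px] pk] := fnorm_chart N x (ltr1n R 2).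
have [c2 [C2 [c20 _ pc2]]] := fnorm_equiv N (conj pM px).
(* [c2] compares the norms at [x]; halving it pays for the variation of the Finsler norm over the
   chart. *)
pose c := c2 / 2; have c0 : 0 < c by rewrite divr_gt0.
have pc z w : cdom p z -> c * `|w| <= fnorm N (tvec M p z w).
  move=> pz; have /andP[h1 _] := pk z w pz; have /andP[h2 _] := pc2 w.
  by rewrite (le_trans _ h1)// /c mulrAC mulrC ler_pM2l ?invr_gt0.
have /nbhs_distP[r r0 rP] := chart_image_nbhs px xO.
exists (c * r); first by rewrite mulr_gt0.
move=> a [U [oU U01 ca Ca]] a1 aL.
have Ua : C1_path_on U a by split.
have [L aL' Lr] : exists2 L : R, (path_length N a <= L%:E)%E & L < c * r.
  have l0 : (0 <= path_length N a)%E by apply: integral_ge0 => t _; rewrite lee_fin fnorm_ge0.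
  exists (fine (path_length N a)).
    by rewrite fineK// ge0_fin_numE// (lt_trans aL)// ltry.
  by rewrite -lte_fin fineK// ge0_fin_numE// (lt_trans aL)// ltry.
pose ok s := cdom p (a s) /\ `|p (a s) - p x| < r.
have ok1 : ok 1 by rewrite /ok a1 subrr normr0.
have cU t : 0 <= t <= 1 -> {for t, continuous a}.
  by move=> t01; apply: ca; apply: U01; rewrite /= in_itv.
have disp t : 0 <= t <= 1 -> (forall s, t <= s <= 1 -> ok s) ->
    `|p (a t) - p x| <= L / c.
  move=> /andP[t0]; rewrite le_eqVlt => /orP[/eqP->|t1] tok.
    rewrite a1 subrr normr0 divr_ge0 ?(ltW c0)// -lee_fin.
    by apply: le_trans aL'; apply: integral_ge0 => t' _; rewrite lee_fin fnorm_ge0.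
  rewrite ler_pdivlMr// mulrC distrC -a1.
  apply: (@chart_displacement_le U a p c t L) => //; first by rewrite t0.
  by move=> s /tok[].
(* Times from which the path stays [ok] up to 1; their infimum [t0] turns out to be 0. *)
pose S := [set t | 0 <= t <= 1 /\ forall s, t <= s <= 1 -> ok s].
have S1 : S 1 by split=> [|s]; rewrite ?ler01 ?lexx// => /le_anti <-.
have hS : has_inf S by split; [exists 1|exists 0 => t [/andP[]]].
set t0 := inf S.
have t00 : 0 <= t0 by apply: lb_le_inf; [exists 1|move=> t [/andP[]]].
have t01 : t0 <= 1 by apply: ge_inf => //; exact: hS.2.
have okR s : t0 < s <= 1 -> ok s.
  move=> /andP[t0s s1]; have [|t [_ tok] ts] := inf_lt _ t0s; first by exists 1.
  by apply: tok; rewrite (ltW ts).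
have t0P : 0 <= t0 <= 1 by rewrite t00.
(* At [t0] the path might already be outside [cdom p], so [p (a t0)] cannot be estimated directly.
   Instead the coordinates are Cauchy from the right; their limit [w] is within [L / c < r] of
   [p x], hence in the image of [p], and Hausdorffness identifies [a t0] with [cinv p w]. *)
have okt0 : ok t0.
  have [->//|t0n1] := eqVneq t0 1.
  have t0lt : t0 < 1 by rewrite lt_def eq_sym t0n1.
  pose K := fnorm N (velocity M a t0) + 1.
  have t0U : U t0 by apply: U01; rewrite /= in_itv.
  have K0 : 0 < K by rewrite ltr_wpDl// fnorm_ge0.
  have /continuous_distP/(_ _ ltr01)[h h0 hP] := speed_continuous Ua t0U.
  have speedK s : `|s - t0| < h -> fnorm N (velocity M a s) <= K.
    move=> /hP; have := ler_norm (fnorm N (velocity M a s) - fnorm N (velocity M a t0)).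
    by rewrite /K; lra.
  have lip s t : t0 < s -> s <= t -> t <= 1 -> `|t - t0| < h ->
      `|p (a t) - p (a s)| <= K / c * (t - s).
    move=> t0s st t1 th.
    apply: (@mean_value_ineq _ _ (p \o a) (fun u => path_derivative (p \o a) u)) => // u /andP[su ut].
      have uok : ok u by apply: okR; rewrite (lt_le_trans t0s su) (le_trans ut t1).
      have uU : U u by apply: U01; rewrite /= in_itv /= (le_trans ut t1) (le_trans t00)// ltW// (lt_le_trans t0s).
      have [T sT] := path_sdiff Ua pM uU uok.1.
      have [df _] := sdiff_differentiable sT.
      by apply: DeriveDef; [exact: diff_derivable|rewrite /path_derivative deriveE].
    have uok : ok u by apply: okR; rewrite (lt_le_trans t0s su) (le_trans ut t1).
    have uU : U u by apply: U01; rewrite /= in_itv /= (le_trans ut t1) (le_trans t00)// ltW// (lt_le_trans t0s).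
    rewrite ler_pdivlMr// mulrC (le_trans (pc _ _ uok.1))//.
    rewrite -(velocity_diff Ua pM uU uok.1) speedK//.
    apply: le_lt_trans th; rewrite !ger0_norm ?subr_ge0; last 2 first.
    - by rewrite (le_trans _ ut)// (le_trans _ su)// ltW.
    - by rewrite (le_trans _ su)// ltW.
    by rewrite lerD2r.
  have cvga : cvg (p (a s) @[s --> t0^'+]).
    apply/cauchy_cvgP; apply: cauchy_exP => e e0.
    (* The three terms stay in the range of the speed bound, in the parameter interval, and make
       [K / c * h'] at most [e / 2]. *)
    pose h' := Order.min (Order.min (h / 2) (1 - t0)) (e * c / (2 * K)).
    have h'0 : 0 < h' by rewrite !lt_min subr_gt0 t0lt !divr_gt0//= mulr_gt0.
    have h'1 : h' <= h / 2 by rewrite /h' !ge_min lexx.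
    have h'2 : h' <= 1 - t0 by rewrite /h' !ge_min lexx orbT.
    have h'3 : h' <= e * c / (2 * K) by rewrite /h' ge_min lexx orbT.
    exists (p (a (t0 + h'))).
    have t0h : t0 < t0 + h' by rewrite ltrDl.
    have lt_h := nbhs_right_lt t0h; have gt_t0 := nbhs_right_gt t0.
    apply: filterS2 lt_h gt_t0 => s sh t0s; rewrite -ball_normE /=.
    have th : t0 + h' - t0 = h' by rewrite addrAC subrr add0r.
    have hh : h' < h by lra.
    apply: (@le_lt_trans _ _ (K / c * (t0 + h' - s))).
      by apply: lip => //; rewrite ?(ltW sh)// ?th ?gtr0_norm//; lra.
    have Kc : 0 < K / c by rewrite divr_gt0.
    apply: (@le_lt_trans _ _ (K / c * h')); first by rewrite ler_pM2l//; lra.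
    apply: (@le_lt_trans _ _ (K / c * (e * c / (2 * K)))); first by rewrite ler_pM2l.
    have -> : K / c * (e * c / (2 * K)) = e / 2.
      by field; rewrite !gt_eqF.
    lra.
  pose w := lim (p (a s) @[s --> t0^'+]).
  have cw : p (a s) @[s --> t0^'+] --> w by exact: cvga.
  have lt_1 := nbhs_right_lt t0lt; have gt_t0 := nbhs_right_gt t0.
  have wL : `|w - p x| <= L / c.
    apply/ler_addgt0Pl => e e0; have /cvgrPdist_lt/(_ _ e0) we := cw.
    have [s [[s1 t0s] ws]] := filter_ex (filterI (filterI lt_1 gt_t0) we).
    have := ler_normD (w - p (a s)) (p (a s) - p x); rewrite subrKA => tri.
    have : `|p (a s) - p x| <= L / c.
      apply: disp; first by rewrite (ltW s1) (le_trans t00)// ltW.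
      by move=> u /andP[su u1]; apply: okR; rewrite (lt_le_trans t0s su).
    by move: ws => /=; lra.
  have wr : `|w - p x| < r by rewrite (le_lt_trans wL)// ltr_pdivrMr// mulrC.
  have [pw [_ pwK]] := rP _ wr.
  have c1 : a s @[s --> t0^'+] --> cinv p w.
    have ci : cinv p (p (a s)) @[s --> t0^'+] --> cinv p w.
      have cp : {for w, continuous (cinv p)} by rewrite -pwK; exact: cinv_continuous.
      exact: (cvg_comp _ _ cw cp).
    apply: cvg_trans ci; apply: near_eq_cvg.
    apply: filterS2 lt_1 gt_t0 => s s1 t0s.
    by rewrite cfunK//; have [|] := okR s _; rewrite ?t0s ?ltW.
  have cat0 : a s @[s --> t0^'+] --> a t0 by apply: cvg_at_right_filter; exact: cU.
  have -> : ok t0 = (cdom p (a t0) /\ `|p (a t0) - p x| < r) by [].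
  by rewrite (cvg_unique hX cat0 c1) pwK.
have [t0eq|t0n0] := eqVneq t0 0.
  have [pa ra] := okt0; rewrite t0eq in pa ra.
  by have [_ [+ _]] := rP _ ra; rewrite cfunK.
have t0gt : 0 < t0 by rewrite lt_def t0n0.
have near_ok : \forall s \near t0, ok s.
  apply: filterI; first exact: (cU _ t0P _ (chart_nbhs okt0.1)).
  have cpa : {for t0, continuous (p \o a)}.
    by apply: continuous_comp; [exact: cU|exact: (cfun_continuous okt0.1)].
  have d0 : 0 < r - `|p (a t0) - p x| by rewrite subr_gt0 okt0.2.
  have /cvgrPdist_lt/(_ _ d0) := cpa; apply: filterS => s /= h.
  have := ler_normD (p (a s) - p (a t0)) (p (a t0) - p x); rewrite subrKA.
  by rewrite [`|p (a s) - p (a t0)|]distrC; lra.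
have /nbhs_distP[d d0 dP] := near_ok.
pose t := Order.max 0 (t0 - d / 2).
have tt0 : t < t0 by rewrite gt_max t0gt /=; lra.
suff St : S t by have := ge_inf hS.2 St; rewrite -/t0 leNgt tt0.
split; first by rewrite le_max lexx (le_trans (ltW tt0)).
move=> s /andP[ts s1]; have [st0|st0] := leP s t0; last by apply: okR; rewrite st0.
apply: dP; rewrite ler0_norm ?subr_le0// opprB.
have : t0 - d / 2 <= s by rewrite (le_trans _ ts)// le_max lexx orbT.
lra.
Qed.

End Paths.

(** * Lifting over a convex ball *)

Section Lifting.
Context {R : realType} {E F : completeNormedModType R} {X Y : topologicalType}.
Variables (MX : manifold E X) (MY : manifold F Y) (NX : finsler MX) (f : X -> Y).
Hypothesis fC1 : C1_map MX MY f.
Hypothesis fiso : forall x, exists2 c : R, 0 < c &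
  (forall v : E, c * `|v| <= `|tdiff MX MY f x v : F|) /\
  exists S : {linear F -> E}, cancel S (tdiff MX MY f x) /\ cancel (tdiff MX MY f x) S.
Hypotheses (hX : hausdorff_space X) (hY : hausdorff_space Y).
Hypothesis cX : finsler_complete NX.

Variables (q : chart F Y) (B : set F) (K : R).
Hypotheses (qM : chart_of MY q) (oB : open B) (K0 : 0 <= K).
Hypothesis Bconv : forall u v (t : R), B u -> B v -> 0 <= t <= 1 -> B (u + t *: (v - u)).
Hypothesis Bq : B `<=` q @` cdom q.
Hypothesis BK : forall w x v u, B w -> f x = cinv q w ->
  tdiff MX MY f x v = tvec MY q (f x) u -> fnorm NX (v : tangent MX x) <= K * `|u|.

Definition section_at (s : F -> X) (w : F) := f (s w) = cinv q w /\ {for w, continuous s}.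

Lemma line_sdiff (G : normedModType R) (w v : G) (t : R) :
  exists T : {linear R^o -> G}, T 1 = v /\ @sdiff R R^o G (fun s => w + s *: v) t T.
Proof.
have llin : linear (( *:%R^~ v) : R^o -> G).
  by move=> a x y; rewrite scalerDl scalerA.
pose T : {linear R^o -> G} := HB.pack (( *:%R^~ v) : R^o -> G)
  (GRing.isLinear.Build R R^o G *:%R (( *:%R^~ v) : R^o -> G) llin).
exists T; split; first exact: scale1r.
have cT : continuous T by move=> x; exact: scalel_continuous.
split=> // e e0; exists 1 => // y z _ _.
have -> : w + y *: v - (w + z *: v) = T (y - z).
  by rewrite opprD addrACA subrr add0r -scalerBl.
by rewrite subrr normr0 mulr_ge0// ltW.
Qed.

(** Along a line a section is strictly differentiable at each time, hence C^1. The speed bound is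
    [BK] applied to the vector lifting [v]. *)
Lemma section_path (W : set F) (s : F -> X) (w v : F) : open W -> W `<=` B ->
  (forall u, W u -> section_at s u) ->
  C1_path_on MX [set t | W (w + t *: v)] (fun t => s (w + t *: v)) /\
  forall t, W (w + t *: v) ->
    fnorm NX (velocity MX (fun t => s (w + t *: v)) t) <= K * `|v|.
Proof.
move=> oW WB sW; pose a (t : R) := s (w + t *: v).
have cl t : {for t, continuous (fun t : R => w + t *: v)}.
  by have [T [_ sT]] := line_sdiff w v t; exact: (sdiff_continuous sT).
have ca t : W (w + t *: v) -> {for t, continuous a}.
  move=> Wt; apply: (@continuous_comp _ _ _ (fun t : R => w + t *: v) s); first exact: cl.
  by have [] := sW _ Wt.
have oU : open [set t | W (w + t *: v)].
  rewrite openE => t Wt; rewrite /interior.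
  exact: (cl t _ (open_nbhs_nbhs (conj oW Wt))).
have deriv t : W (w + t *: v) -> exists2 T : {linear R^o -> E},
    @sdiff R R^o E (chart0 MX (a t) \o a) t T & fnorm NX (T 1 : tangent MX (a t)) <= K * `|v|.
  move=> Wt; have [fs cs] := sW _ Wt.
  have Wn : \forall u \near w + t *: v, f (s u) = cinv q u.
    by apply: filterS (open_nbhs_nbhs (conj oW Wt)) => u /sW[].
  have [D [sD DE]] := section_sdiff fC1 fiso qM (Bq (WB _ Wt)) cs Wn.
  have [T [T1 sT]] := line_sdiff w v t.
  exists (D \o T); first exact: (@sdiff_comp _ _ _ _ _ (chart0 MX (a t) \o s) t T D sT sD).
  rewrite /= T1; apply: (BK (WB _ Wt)); first exact: fs.
  exact: DE.
have aU : C1_path_on MX [set t | W (w + t *: v)] a.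
  split=> // p pM; apply: sdiff_C1_on.
    rewrite openE => t [Wt pt]; apply: filterI; first exact: open_nbhs_nbhs.
    exact: (ca _ Wt _ (chart_nbhs pt)).
  move=> t [Wt pt]; have [T sT _] := deriv _ Wt.
  eexists; apply: (@chart_change_sdiff R E X R^o a _ p t _ (ca _ Wt) _ _ pt sT).
    exact: (atlas_C1 (m := MX)) (chart0_atlas _ _) pM.
  exact: chart0_dom.
split=> // t Wt; have [T sT TK] := deriv _ Wt.
rewrite (velocity_chart (atlas_chart_of (chart0_atlas MX (a t))) (chart0_dom _ _) (ca _ Wt) sT).
by rewrite tvec_chart0.
Qed.

Definition convex_in (C : set F) :=
  forall u v (t : R), C u -> C v -> 0 <= t <= 1 -> C (u + t *: (v - u)).

(** The segment from [w] to [u] lies in [C], and over it uniqueness of lifts on an interval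
    applies. *)
Lemma convex_section_unique (C : set F) (s t : F -> X) w u : convex_in C ->
  (forall v, C v -> section_at s v) -> (forall v, C v -> section_at t v) ->
  C w -> C u -> s w = t w -> s u = t u.
Proof.
move=> cC sC tC Cw Cu swt.
pose l (r : R) := w + r *: (u - w).
have cl r : {for r, continuous l}.
  by have [T [_ sT]] := line_sdiff w (u - w) r; exact: (sdiff_continuous sT).
have Cl r : `[0, 1]%classic r -> C (l r).
  by rewrite /= in_itv /= => r01; exact: cC.
have sec z r : (forall v, C v -> section_at z v) -> `[0, 1]%classic r ->
    f ((z \o l) r) = cinv q (l r) /\ {for r, continuous (z \o l)}.
  move=> zC r01; have [fz cz] := zC _ (Cl _ r01); split=> //.
  by apply: continuous_comp; [exact: cl|exact: cz].
have := @section_unique R E F X Y MX MY f fC1 fiso R (cinv q \o l) `[0, 1]%classic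
  (s \o l) (t \o l) 0 hX (@segment_connected _ _ _).
move=> /(_ (fun r => sec s r sC) (fun r => sec t r tC)).
rewrite /= in_itv /= lexx ler01 /l scale0r addr0 => /(_ isT swt 1).
by rewrite in_itv /= lexx ler01 scale1r addrC subrK; apply.
Qed.

Variables (w0 : F) (x0 : X).
Hypotheses (Bw0 : B w0) (fx0 : f x0 = cinv q w0).

(* The sections over convex open subsets of [B] that lift [w0] to [x0] agree on
   intersections, which are convex; [reach] is the union of their domains and
   [glue] their common extension. *)
Definition partial_section (C : set F) (s : F -> X) : Prop :=
  [/\ open C, C `<=` B, convex_in C, C w0 & s w0 = x0 /\ forall w, C w -> section_at s w].

Definition reach : set F := [set w | exists C s, partial_section C s /\ C w].

Definition glue (w : F) : X :=
  xget x0 [set x | exists C s, [/\ partial_section C s, C w & s w = x]].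

Lemma glueE C s w : partial_section C s -> C w -> glue w = s w.
Proof.
move=> Cs Cw; rewrite /glue; case: xgetP => [x -> [C' [s' [Cs' Cw' <-]]]|]; last first.
  by move=> /(_ (s w)); case; exists C, s.
have [oC CB cC C0 [s0 sC]] := Cs; have [oC' CB' cC' C0' [s0' sC']] := Cs'.
apply: (@convex_section_unique (C `&` C') _ _ w0) => //.
- by move=> u v t [? ?] [? ?] t01; split; [exact: cC|exact: cC'].
- by move=> v [_ /sC'].
- by move=> v [/sC].
- by rewrite s0 s0'.
Qed.

Lemma glue_section w : reach w -> section_at glue w.
Proof.
move=> [C [s [Cs Cw]]]; have [oC CB cC C0 [s0 sC]] := Cs.
have [fs cs] := sC _ Cw; split; first by rewrite (glueE Cs Cw).
have near_s : \forall u \near w, s u = glue u.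
  by apply: filterS (open_nbhs_nbhs (conj oC Cw)) => u Cu; rewrite (glueE Cs Cu).
rewrite /prop_for /continuous_at (glueE Cs Cw).
by apply: cvg_trans cs; exact: near_eq_cvg.
Qed.

Lemma reach_open : open reach.
Proof.
rewrite openE => w [C [s [Cs Cw]]]; have [oC _ _ _ _] := Cs; rewrite /interior.
by apply: filterS (open_nbhs_nbhs (conj oC Cw)) => u Cu; exists C, s.
Qed.

Lemma reach_sub : reach `<=` B.
Proof. by move=> w [C [s [[_ CB _ _ _] /CB]]]. Qed.

Lemma ball_convex (c : F) (r : R) u v (t : R) :
  `|u - c| < r -> `|v - c| < r -> 0 <= t <= 1 -> `|u + t *: (v - u) - c| < r.
Proof.
move=> ur vr /andP[t0 t1].
have -> : u + t *: (v - u) - c = t *: (v - c) + (1 - t) *: (u - c).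
  have -> : v - u = (v - c) - (u - c) by rewrite opprB addrA subrK.
  by rewrite (scalerBr t (v - c)) scalerBl scale1r addrAC addrCA.
rewrite (le_lt_trans (ler_normD _ _))// !normrZ ger0_norm// ger0_norm ?subr_ge0//.
have [->|tn0] := eqVneq t 0; first by rewrite mul0r add0r subr0 mul1r.
have tp : 0 < t by rewrite lt_def tn0.
have : t * `|v - c| < t * r by rewrite ltr_pM2l.
have : (1 - t) * `|u - c| <= (1 - t) * r.
  by rewrite ler_wpM2l// ?subr_ge0// ltW.
lra.
Qed.

Lemma cinv_chart_continuous w : B w -> {for w, continuous (cinv q)}.
Proof.
by move=> /Bq[x qx <-]; exact: cinv_continuous.
Qed.

(** The neighbourhood [Q] records uniqueness: any other lift that comes close to [x] is identified
    with [g]. *)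
Lemma ball_section w x : B w -> f x = cinv q w -> exists2 d : R, 0 < d &
  exists2 g : F -> X, g w = x & exists2 Q : set X, nbhs x Q &
    forall u, `|u - w| < d -> [/\ B u, section_at g u &
      forall x', Q x' -> f x' = cinv q u -> x' = g u].
Proof.
move=> Bw fx.
have [V xV [s [sx sV]]] := local_section fC1 fiso x.
have [Q xO Oinj] := locally_injective fC1 fiso x.
have cq := cinv_chart_continuous Bw.
have h1 : \forall u \near w, V (cinv q u) by apply: cq; rewrite -fx.
have cs : {for f x, continuous s} by have [] := sV _ (nbhs_singleton xV).
have h2 : \forall u \near w, Q (s (cinv q u)).
  have H : nbhs (cinv q w) (s @^-1` Q) by rewrite -fx; apply: cs; rewrite sx.
  exact: (cq _ H).
have h3 : \forall u \near w, B u by apply: open_nbhs_nbhs.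
have : \forall u \near w, (V (cinv q u) /\ Q (s (cinv q u))) /\ B u.
  by apply: filterI h3; exact: filterI.
move=> /nbhs_distP[d d0 dP].
exists d => //; exists (s \o cinv q); first by rewrite /= -fx.
exists Q => // u /dP[[Vu Ou] Bu]; have [fs csu] := sV _ Vu; split=> //.
  by split=> //; apply: continuous_comp => //; exact: cinv_chart_continuous.
by move=> x' Ox' fx'; apply: Oinj => //; rewrite fx'.
Qed.

Lemma reach_base : reach w0.
Proof.
have [d d0 [g gw [Q xO gP]]] := ball_section Bw0 fx0.
exists [set u | `|u - w0| < d], g; split; last by rewrite /= subrr normr0.
split.
- rewrite openE => u /= ud; apply/nbhs_distP; exists (d - `|u - w0|); first by rewrite subr_gt0.
  by move=> v vu /=; have := ler_normD (v - u) (u - w0); rewrite subrKA; lra.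
- by move=> u /gP[].
- by move=> u v t; exact: ball_convex.
- by rewrite /= subrr normr0.
- by split=> // u /gP[].
Qed.

Lemma glue_base : glue w0 = x0.
Proof.
have [C [s [Cs Cw0]]] := reach_base.
by rewrite (glueE Cs Cw0); have [_ _ _ _ []] := Cs.
Qed.

Lemma itv_convex (a b T r : R) : 0 <= a < T -> 0 <= b < T -> 0 <= r <= 1 ->
  0 <= a + r * (b - a) < T.
Proof.
move=> /andP[a0 aT] /andP[b0 bT] /andP[r0 r1].
have h1 : 0 <= r * b by rewrite mulr_ge0.
have h2 : 0 <= (1 - r) * a by rewrite mulr_ge0// subr_ge0.
have [ab|ab] := leP a b.
  have : r * (b - a) <= b - a by rewrite ler_piMl// subr_ge0.
  lra.
have : r * (a - b) >= 0 by rewrite mulr_ge0// subr_ge0 ltW.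
lra.
Qed.

(** The lift of the segment between the two times, run affinely over the unit interval, is an
    admissible path; [t1] may exceed [t2]. *)
Lemma glue_dist (v : F) (t1 t2 : R) :
  (forall r, 0 <= r <= 1 -> reach (w0 + (t1 + r * (t2 - t1)) *: v)) ->
  (finsler_dist NX (glue (w0 + t1 *: v)%R) (glue (w0 + t2 *: v)%R)
    <= (K * `|v| * `|t1 - t2|)%:E)%E.
Proof.
move=> rt.
have [aU aK] := section_path (w0 + t1 *: v) ((t2 - t1) *: v) reach_open reach_sub glue_section.
set a := fun t => glue _ in aU aK.
have aE r : w0 + t1 *: v + r *: ((t2 - t1) *: v) = w0 + (t1 + r * (t2 - t1)) *: v.
  by rewrite scalerA -addrA -scalerDl.
have U01 : `[0, 1]%classic `<=` [set t | reach (w0 + t1 *: v + t *: ((t2 - t1) *: v))].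
  by move=> r; rewrite /= in_itv /= => r01; rewrite aE; exact: rt.
apply: (@le_trans _ _ (path_length NX a)).
  apply: ereal_inf_lbound; exists a => //; split.
  - by have [oU ca Ca] := aU; eexists; split; [exact: oU|exact: U01|exact: ca|exact: Ca].
  - by rewrite /a scale0r addr0.
  - by rewrite /a aE mul1r [t1 + _]addrC subrK.
apply: (path_length_le aU U01) => t t01.
have -> : K * `|v| * `|t1 - t2| = K * `|(t2 - t1) *: v|.
  by rewrite normrZ distrC mulrAC mulrA.
by apply: aK; apply: U01; rewrite /= in_itv.
Qed.

(** Only accumulation is claimed: the lift visits each neighbourhood of [x] at times arbitrarily
    close to [T]. One such time suffices to attach a local section at [x]. *)
Lemma lift_limit (v : F) (T : R) : 0 < T -> B (w0 + T *: v) ->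
  (forall t, 0 <= t < T -> reach (w0 + t *: v)) ->
  exists2 x, f x = cinv q (w0 + T *: v) & forall Q : set X, nbhs x Q ->
    forall e : R, 0 < e -> exists t, [/\ 0 <= t < T, T - t < e & Q (glue (w0 + t *: v))].
Proof.
move=> T0 BT rT.
(* The offset 2 keeps every [t n] strictly between [0] and [T]. *)
pose d (n : nat) := T * n.+2%:R^-1; pose t n := T - d n.
have d0 n : 0 < d n by rewrite mulr_gt0.
have dT n : d n < T by rewrite gtr_pMr// invf_lt1// ltr1n.
have tT n : 0 <= t n < T by rewrite /t subr_ge0 gtrBl d0 ltW.
have d_small e : 0 < e -> exists N, forall n, (N <= n)%N -> d n < e.
  move=> e0; have [N] := @ltr_add_invr R 0 (e / T) (divr_gt0 e0 T0).
  rewrite add0r => Ne; exists N => n Nn; rewrite /d mulrC -ltr_pdivlMr//.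
  apply: le_lt_trans Ne; rewrite lef_pV2 ?posrE// ler_nat; exact: leq_trans Nn _.
pose u n := glue (w0 + t n *: v).
have Kv0 : 0 <= K * `|v| by rewrite mulr_ge0.
have udist m n : (finsler_dist NX (u m) (u n) <= (K * `|v| * `|t m - t n|)%:E)%E.
  by apply: glue_dist => r r01; apply: rT; exact: itv_convex.
(* Completeness is given componentwise; the lift itself joins [x0] to [u n]. *)
have comp n : connected_component [set: X] x0 (u n).
  pose a (r : R) := glue (w0 + r *: v).
  have ca : {within `[0, t n], continuous a}.
    apply: continuous_in_subspaceT => r; rewrite inE /= in_itv /= => /andP[r0 rn].
    have [[_ h _] _] := section_path w0 v reach_open reach_sub glue_section.
    by apply: h; apply: rT; rewrite r0 (le_lt_trans rn)//; have /andP[] := tT n.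
  have cI := connected_continuous_connected (@segment_connected R 0 (t n)) ca.
  apply: (connected_component_max _ _ cI) => //.
    exists 0; first by rewrite /= in_itv /= lexx; have /andP[->] := tT n.
    by rewrite /a scale0r addr0 glue_base.
  by exists (t n) => //; rewrite /= in_itv /= lexx andbT; have /andP[->] := tT n.
have cauchy e : 0 < e -> exists n0, forall m n, (n0 <= m)%N -> (n0 <= n)%N ->
    (finsler_dist NX (u m) (u n) < e%:E)%E.
  move=> e0; have [N NP] := d_small (e / (K * `|v| + 1)) (divr_gt0 e0 (ltr_wpDl Kv0 ltr01)).
  exists N => m n Nm Nn; apply: le_lt_trans (udist m n) _; rewrite lte_fin.
  have tmn : `|t m - t n| <= e / (K * `|v| + 1).
    have := NP _ Nm; have := NP _ Nn; have := d0 m; have := d0 n.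
    by rewrite ler_norml /t => *; apply/andP; split; lra.
  have : K * `|v| * `|t m - t n| <= K * `|v| * (e / (K * `|v| + 1)) by rewrite ler_wpM2l.
  move/le_lt_trans; apply; rewrite mulrA ltr_pdivrMr ?ltr_wpDl//.
  by rewrite mulrDr mulr1 mulrC ltrDl.
have [l _ ul] := cX comp cauchy.
(* A distance below [e] provides a path from [u n] to [l] of length below [e], which forces [u n]
   into the given neighbourhood. *)
have u_l : u n @[n --> \oo] --> l.
  move=> Q lQ; have [e e0 eP] := small_length_close NX lQ hX.
  have e_nbhs : nbhs (0%E : \bar R) [set y | (y < e%:E)%E].
    by apply: open_nbhs_nbhs; split; [exact: open_ereal_lt_ereal|rewrite /= lte_fin].
  have h : \forall n \near \oo, (finsler_dist NX (u n) l < e%:E)%E := ul _ e_nbhs.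
  apply: filterS h => n /= /ereal_inf_lt[_ [a [aC a0 a1] <-] ae].
  by rewrite -a0; exact: eP.
have t_T : w0 + t n *: v @[n --> \oo] --> w0 + T *: v.
  apply/cvgrPdist_lt => e e0.
  have [N NP] := d_small (e / (`|v| + 1)) (divr_gt0 e0 (ltr_wpDl (normr_ge0 v) ltr01)).
  exists N => // n /= /NP dn; rewrite opprD addrACA subrr add0r -scalerBl normrZ.
  have -> : T - t n = d n by rewrite /t opprB addrC subrK.
  rewrite gtr0_norm//.
  have h : d n * `|v| <= e / (`|v| + 1) * `|v| by rewrite ler_wpM2r// ltW.
  apply: le_lt_trans h _; rewrite mulrAC ltr_pdivrMr ?ltr_wpDl//.
  by rewrite mulrDr mulr1 ltrDl.
exists l.
  have c1 : f (u n) @[n --> \oo] --> f l := cvg_comp _ _ u_l (map_continuous fC1 (x := l)).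
  have c2 : f (u n) @[n --> \oo] --> cinv q (w0 + T *: v).
    have c3 := cvg_comp _ _ t_T (cinv_chart_continuous BT).
    apply: cvg_trans c3; apply: near_eq_cvg; near=> n.
    by rewrite /u /=; have [-> _] := glue_section (rT _ (tT n)).
  exact: (cvg_unique hY c1 c2).
move=> Q lQ e e0; have [N NP] := d_small _ e0.
have nQ : \forall n \near \oo, Q (u n) := u_l _ lQ.
have nN : \forall n \near \oo, (N <= n)%N by exists N.
have [n [Qn Nn]] := filter_ex (filterI nQ nN).
by exists (t n); split=> //; rewrite /t opprB addrC subrK NP.
Unshelve. all: by end_near. Qed.

(* A section near [w0 + T *: v] extends one given on a convex set containing
   [w0] and a point [w0 + t *: v] with [t] close to [T]; the extension lives on a
   thin convex tube [C'] around the segment from [w0] to beyond [w0 + T *: v]. *)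
Lemma reach_step (v : F) (T : R) : 0 < T -> B (w0 + T *: v) ->
  (forall t, 0 <= t < T -> reach (w0 + t *: v)) ->
  exists2 e : R, 0 < e & forall t, 0 <= t < T + e -> B (w0 + t *: v) ->
    reach (w0 + t *: v).
Proof.
move=> T0 BT rT; have [x fx xP] := lift_limit T0 BT rT.
have [d d0 [g gT [Q xQ gP]]] := ball_section BT fx.
(* Times within [e] of [T] give points of the line within [d / 2] of its end; the summand 1 covers
   [v = 0]. *)
pose e := d / 2 / (`|v| + 1).
have v1 : 0 < `|v| + 1 by rewrite ltr_wpDl.
have e0 : 0 < e by rewrite !divr_gt0.
have ev : e * `|v| <= d / 2.
  by rewrite /e -mulrA ler_piMr ?divr_ge0 ?(ltW d0)// mulrC ler_pdivrMr// mul1r lerDl.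
have [t [/andP[t0 tT] tTe Qt]] := xP _ xQ _ e0.
have rt : reach (w0 + t *: v) by apply: rT; rewrite t0.
have closeT r : `|r - T| < e -> `|w0 + r *: v - (w0 + T *: v)| <= d / 2.
  move=> re; rewrite opprD addrACA subrr add0r -scalerBl normrZ.
  by rewrite (le_trans _ ev)// ler_wpM2r// ltW.
have tTe' : `|t - T| < e by rewrite ltr0_norm ?subr_lt0// opprB.
have dd : d / 2 < d by lra.
(* The lift at time [t] lies in [Q], so [g] continues the old section and not another sheet. *)
have gt : glue (w0 + t *: v) = g (w0 + t *: v).
  have [_ _ h] := gP _ (le_lt_trans (closeT _ tTe') dd).
  by apply: h => //; have [] := glue_section rt.
have [C [s [Cs Ct]]] := rt; have [oC CB cC C0 [s0 sC]] := Cs.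
have st : s (w0 + t *: v) = g (w0 + t *: v) by rewrite -gt (glueE Cs Ct).
have agree w : C w -> `|w - (w0 + T *: v)| < d -> s w = g w.
  move=> Cw wd.
  apply: (@convex_section_unique (C `&` [set w | `|w - (w0 + T *: v)| < d]) _ _ (w0 + t *: v)) => //.
  - move=> u1 u2 r [C1 d1] [C2 d2] r01; split; [exact: cC|exact: ball_convex].
  - by move=> u [/sC].
  - by move=> u [_ /gP[]].
  - by split => //; exact: le_lt_trans (closeT _ tTe') dd.
have /nbhs_distP[e1 e10 e1P] := open_nbhs_nbhs (conj oC C0).
have /nbhs_distP[e2 e20 e2P] := open_nbhs_nbhs (conj oC Ct).
(* A translation by less than [r] keeps both ends of the segment from [w0] to [w0 + t *: v] in [C],
   hence all of it; past [t], width below [d / 2] and at most [d / 2] along the line stay in the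
   ball of radius [d]. *)
pose r := Order.min (Order.min e1 e2) (d / 2).
have r0 : 0 < r by rewrite !lt_min e10 e20 divr_gt0.
have re1 : r <= e1 by rewrite /r !ge_min lexx.
have re2 : r <= e2 by rewrite /r !ge_min lexx orbT.
have rd : r <= d / 2 by rewrite /r ge_min lexx orbT.
pose C' : set F := [set w | B w /\
  exists2 z : R, 0 <= z < T + e & `|w - (w0 + z *: v)| < r].
have C'P w : C' w -> C w \/ `|w - (w0 + T *: v)| < d.
  move=> [Bw [z /andP[z0 zT] wz]]; have [zt|tz] := leP z t.
    left; pose h := w - (w0 + z *: v).
    have hr : `|h| < r by [].
    have C1 : C (w0 + h) by apply: e1P; rewrite addrAC subrr add0r (lt_le_trans hr).
    have C2 : C (w0 + t *: v + h) by apply: e2P; rewrite addrAC subrr add0r (lt_le_trans hr).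
    (* [z / t] is the position on the translated segment; for [t = 0] the quotient is 0 by
       convention, and so is [z]. *)
    have th : 0 <= z / t <= 1.
      rewrite divr_ge0//=; have [->|tn0] := eqVneq t 0; first by rewrite invr0 mulr0.
      by rewrite ler_pdivrMr ?mul1r// lt_def tn0.
    have := cC _ _ _ C1 C2 th.
    have -> : w0 + t *: v + h - (w0 + h) = t *: v.
      by rewrite opprD addrACA subrr addr0 addrAC subrr add0r.
    rewrite scalerA.
    have -> : z / t * t = z.
      have [t0'|tn0] := eqVneq t 0; last by rewrite divfK.
      by apply/eqP; rewrite t0' mulr0 eq_sym eq_le z0 -t0' zt.
    by rewrite addrAC /h addrC subrK.
  right; have zT' : `|z - T| < e by rewrite ltr_norml; apply/andP; split; lra.
  have := closeT _ zT'; have := ler_normD (w - (w0 + z *: v)) (w0 + z *: v - (w0 + T *: v)).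
  by rewrite subrKA; lra.
pose s' w := if `[< C w >] then s w else g w.
have s'C w : C w -> s' w = s w by move=> Cw; rewrite /s'; case: asboolP.
have s'd w : `|w - (w0 + T *: v)| < d -> s' w = g w.
  by move=> wd; rewrite /s'; case: asboolP => // Cw; exact: agree.
have oball : open [set w | `|w - (w0 + T *: v)| < d].
  rewrite openE => w /= wd; apply/nbhs_distP; exists (d - `|w - (w0 + T *: v)|); first by rewrite subr_gt0.
  by move=> w' w'd /=; have := ler_normD (w' - w) (w - (w0 + T *: v)); rewrite subrKA; lra.
have germ (A : set F) k w : open A -> A w -> section_at k w -> (forall u, A u -> s' u = k u) ->
    section_at s' w.
  move=> oA Aw [fk ck] kE; split; first by rewrite kE.
  rewrite /prop_for /continuous_at (kE _ Aw); apply: cvg_trans ck; apply: near_eq_cvg.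
  by apply: filterS (open_nbhs_nbhs (conj oA Aw)) => u Au; rewrite kE.
have C's : partial_section C' s'.
  split.
  - rewrite openE => w [Bw [z zT wz]].
    have h1 : nbhs w B by exact: open_nbhs_nbhs.
    have h2 : \forall u \near w, `|u - (w0 + z *: v)| < r.
      apply/nbhs_distP; exists (r - `|w - (w0 + z *: v)|); first by rewrite subr_gt0.
      by move=> u ud; have := ler_normD (u - w) (w - (w0 + z *: v)); rewrite subrKA; lra.
    by apply: filterS2 h1 h2 => u Bu ud; split=> //; exists z.
  - by move=> w [].
  - move=> u1 u2 k [B1 [z1 z1T d1]] [B2 [z2 z2T d2]] k01; split; first exact: Bconv.
    exists (z1 + k * (z2 - z1)); first exact: itv_convex.
    have := @ball_convex 0 r (u1 - (w0 + z1 *: v)) (u2 - (w0 + z2 *: v)) k.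
    rewrite !subr0 => /(_ d1 d2 k01); congr (`|_| < _).
    have -> : u2 - (w0 + z2 *: v) - (u1 - (w0 + z1 *: v)) = (u2 - u1) - (z2 - z1) *: v.
      rewrite [X in _ + X = _]opprD addrACA -opprD; congr (_ - _).
      by rewrite opprD addrACA subrr add0r scalerBl.
    rewrite (scalerBr k (u2 - u1)) addrACA -opprD; congr (_ - _).
    by rewrite scalerA -addrA -scalerDl.
  - by split=> //; exists 0; [rewrite lexx addr_gt0|rewrite scale0r addr0 subrr normr0].
  - split; first by rewrite s'C.
    move=> w /C'P[Cw|wd]; first by apply: (germ C s) => //; exact: sC.
    by apply: (germ _ g w oball) => //; have [] := gP _ wd.
exists e => // z z0T Bz; exists C', s'; split=> //; split=> //.
by exists z => //; rewrite subrr normr0.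
Qed.

Lemma reach_all : B `<=` reach.
Proof.
move=> w1 Bw1; pose v := w1 - w0.
have BL t : 0 <= t <= 1 -> B (w0 + t *: v) by exact: Bconv.
pose D := [set t : R | 0 <= t <= 1 /\ forall s, 0 <= s <= t -> reach (w0 + s *: v)].
have D0 : D 0.
  split=> [|s]; rewrite ?lexx ?ler01// => /le_anti <-.
  by rewrite scale0r addr0; exact: reach_base.
have hD : has_sup D by split; [exists 0|exists 1 => t [/andP[]]].
set T := sup D.
have T0 : 0 <= T by apply: ub_le_sup => //; exact: hD.2.
have T1 : T <= 1 by apply: ge_sup; [exists 0|move=> t [/andP[]]].
have rT t : 0 <= t < T -> reach (w0 + t *: v).
  move=> /andP[t0 tT]; have [|s [_ sr] ts] := sup_gt _ tT; first by exists 0.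
  by apply: sr; rewrite t0 ltW.
have [e e0 eP] : exists2 e : R, 0 < e & forall t, 0 <= t < T + e -> B (w0 + t *: v) ->
    reach (w0 + t *: v).
  (* [reach_step] starts from a positive time; at [T = 0] the openness of [reach] around [w0] takes
     its place. *)
  have [TE|Tn0] := eqVneq T 0; last first.
    by apply: reach_step => //; [rewrite lt_def Tn0|apply: BL; rewrite T0].
  have [L [_ sL]] := line_sdiff w0 v 0.
  have nr : nbhs (w0 + 0 *: v) reach.
    by rewrite scale0r addr0; apply: open_nbhs_nbhs; split; [exact: reach_open|exact: reach_base].
  have /nbhs_distP[e e0 eP] := sdiff_continuous sL nr.
  exists e => // t; rewrite TE add0r => /andP[t0 te] _; apply: eP.
  by rewrite subr0 ger0_norm.
(* This time belongs to [D], so it is at most [T], which is possible only if it equals 1. *)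
pose t1 := Order.min 1 (T + e / 2).
have Dt1 : D t1.
  split; first by rewrite /t1 le_min ler01 ge_min lexx/= addr_ge0// divr_ge0// ltW.
  move=> s /andP[s0]; rewrite /t1 le_min => /andP[s1 sT].
  by apply: eP; [rewrite s0 /=; lra|apply: BL; rewrite s0].
have : t1 <= T by apply: ub_le_sup => //; exact: hD.2.
have [_ /(_ t1)] := Dt1; rewrite lexx andbT => h.
rewrite /t1 ge_min => /orP[T1'|]; last by lra.
have t11 : t1 = 1 by apply/eqP; rewrite eq_le ge_min lexx /= le_min lexx /=; lra.
by move: h; rewrite t11 ler01 scale1r /v addrC subrK; apply.
Qed.

Lemma lift_exists : exists s, s w0 = x0 /\ forall w, B w -> section_at s w.
Proof. by exists glue; split; [exact: glue_base|move=> w /reach_all/glue_section]. Qed.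

End Lifting.

(** * The covering *)

Section EvenCovering.
Context {R : realType} {E F : completeNormedModType R} {X Y : topologicalType}.
Variables (MX : manifold E X) (MY : manifold F Y) (NX : finsler MX) (NY : finsler MY).
Variable f : X -> Y.

(** The common consequence of the two choices of [mu], and the only form in which the lower bound is
    used from here on. *)
Definition locally_expansive : Prop := forall y : Y, exists2 al : R, 0 < al &
  exists2 V : set Y, nbhs y V & forall x (v : tangent MX x), V (f x) ->
    al * fnorm NX v <= fnorm NY (tdiff MX MY f x v).

Hypothesis fred : C1_fredholm0 MX MY f.

Lemma tdiff_continuous x : continuous (tdiff MX MY f x : E -> F).
Proof. by have [fC1 _] := fred; have [] := tdiff_sdiff fC1 x. Qed.

Lemma earle_eells_expansive (mu : X -> \bar R) :
  mu = Inj_diff NX NY f \/ mu = Sur_diff NX NY f ->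
  earle_eells NX f mu -> locally_expansive.
Proof.
move=> muE [_ h] y; have [al al0 [V yV aV]] := h y.
have nX x := finsler_equiv_norm NX x; have nY z := finsler_equiv_norm NY z.
case: muE aV => -> aV.
  exists al => //; exists V => // x v /aV ax.
  apply: (inj_expansive (T := tdiff MX MY f x) (nX x) (nY (f x))) => w w1.
  rewrite -lee_fin; apply: le_trans ax _.
  by apply: ereal_inf_lbound; exists w.
exists (al / 4); first by rewrite divr_gt0.
exists V => // x v /aV ax.
apply: (fredholm_dual_expansive (T := tdiff MX MY f x) (nX x) (nY (f x)) al0) => //.
- exact: tdiff_continuous.
- by have [_ ] := fred; exact.
move=> l cl l1; apply: le_trans ax _.
by apply: ereal_inf_lbound; exists l.
Qed.

Hypothesis exf : locally_expansive.

Lemma expansive_iso (x : X) : exists2 c : R, 0 < c &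
  (forall v : E, c * `|v| <= `|tdiff MX MY f x v : F|) /\
  exists S : {linear F -> E}, cancel S (tdiff MX MY f x) /\ cancel (tdiff MX MY f x) S.
Proof.
have [al al0 [V xV ex]] := exf (f x).
have {}ex v := ex x v (nbhs_singleton xV).
have [_ _ [c [C [c0 C0 hE]]]] := finsler_equiv_norm NX x.
have [_ _ [c' [C' [c'0 C'0 hF]]]] := finsler_equiv_norm NY (f x).
(* [c] compares the Finsler norm of [X] with the model norm from below, [C'] that of [Y] from
   above. *)
pose k := al * c / C'; have k0 : 0 < k by rewrite !divr_gt0// mulr_gt0.
have kT (v : E) : k * `|v| <= `|tdiff MX MY f x v : F|.
  rewrite /k mulrAC ler_pdivrMr// mulrC.
  have /andP[h1 _] := hE v; have /andP[_ h2] := hF (tdiff MX MY f x v).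
  rewrite [leRHS]mulrC; apply: le_trans h2; apply: le_trans (ex v).
  by rewrite mulrC -mulrA ler_pM2l.
exists k => //; split=> //; have [_ fr] := fred.
apply: (fredholm_injective (fr x)) => v w /eqP; rewrite -subr_eq0 -linearB => /eqP vw.
have := kT (v - w); rewrite vw normr0 pmulr_rle0// normr_le0 subr_eq0 => /eqP.
exact.
Qed.

Hypothesis cX : finsler_complete NX.

Lemma evenly_covered (y : Y) : exists V : set Y, [/\ open V, V y &
  exists D : set (set X),
    [/\ f @^-1` V = \bigcup_(U in D) U, trivIset D id &
      forall U, D U -> open U /\ diffeo_onto MX MY f U V]].
Proof.
have [fC1 _] := fred; have fiso := expansive_iso.
have [hX _] := manifold_paracompact MX; have [hY _] := manifold_paracompact MY.
have [al al0 [V yV ex]] := exf y.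
have [q [qM qy] qk] := fnorm_chart NY y (ltr1n R 2).
have [c [C [_ C0 qC]]] := fnorm_equiv NY (conj qM qy).
have /nbhs_distP[r r0 rP] := chart_image_nbhs qy yV.
pose B := [set w | `|w - q y| < r].
(* [al^-1] bounds the inverse differential, 2 is the variation of the Finsler norm over the chart
   [q], and [C] compares that norm at [y] with the model norm. *)
pose K := al^-1 * (2 * C).
have K0 : 0 <= K by rewrite mulr_ge0 ?invr_ge0 ?mulr_ge0// ltW.
have oB : open B.
  rewrite openE => w wr; apply/nbhs_distP; exists (r - `|w - q y|); first by rewrite subr_gt0.
  by move=> u ud; rewrite /B /=; have := ler_normD (u - w) (w - q y); rewrite subrKA; lra.
have Bconv u v (t : R) : B u -> B v -> 0 <= t <= 1 -> B (u + t *: (v - u)).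
  exact: ball_convex.
have Bq : B `<=` q @` cdom q.
  by move=> w /rP[qw [_ wK]]; exists (cinv q w).
have BK w x v u : B w -> f x = cinv q w -> tdiff MX MY f x v = tvec MY q (f x) u ->
    fnorm NX (v : tangent MX x) <= K * `|u|.
  move=> /rP[qw [Vw _]] fx vu.
  have Vx : V (f x) by rewrite fx.
  have qx : cdom q (f x) by rewrite fx.
  rewrite -mulrA ler_pdivlMl// (le_trans (ex x v Vx))// vu.
  have /andP[_ h1] := qk (f x) u qx; have /andP[_ h2] := qC u.
  by rewrite (le_trans h1)// -mulrA ler_pM2l.
pose W := cdom q `&` q @^-1` B.
have BW w : B w -> W (cinv q w) /\ q (cinv q w) = w.
  by move=> Bw; have [qw [_ wK]] := rP _ Bw; split=> //; split=> //; rewrite /= wK.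
have WB z : W z -> B (q z) /\ cinv q (q z) = z by move=> [qz Bz]; split=> //; exact: cfunK.
have oW : open W.
  rewrite openE => z [qz Bz]; apply: filterI; first exact: chart_nbhs.
  exact: (cfun_continuous qz (open_nbhs_nbhs (conj oB Bz))).
exists W; split=> //; first by split=> //; rewrite /B /= subrr normr0.
pose is_section s := forall w, B w -> section_at f q s w.
have fsec s z : is_section s -> W z -> f (s (q z)) = z.
  by move=> sB /WB[Bz qz]; have [-> _] := sB _ Bz.
have csec s z : is_section s -> W z -> {for z, continuous (s \o q)}.
  move=> sB [qz Bz]; apply: continuous_comp; first exact: cfun_continuous.
  by have [] := sB _ Bz.
(* Sections that differ only outside [B] give the same sheet, since the family is a set of sets. *)
exists [set U | exists2 s, is_section s & U = (s \o q) @` W]; split.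
- apply/seteqP; split=> [x Wx|x [_ [s sB ->] [z Wz <-]]]; last by rewrite /= fsec.
  have [Bx qx] := WB _ Wx.
  have [s [sx sB]] := lift_exists fC1 fiso hX hY cX qM oB K0 Bconv Bq BK Bx (esym qx).
  by exists ((s \o q) @` W); [exists s|exists (f x)].
(* Two sheets with a common point come from sections equal at one point of the convex set [B], hence
   on all of it; so sheets that meet coincide. *)
- move=> _ _ [s sB ->] [s' s'B ->] [x [[z Wz <-] [z' Wz' /= e]]].
  have zz' : z' = z by move/(congr1 f): e; rewrite !fsec.
  have [Bz _] := WB _ Wz.
  have ss' w : B w -> s w = s' w.
    move=> Bw; apply: (convex_section_unique fC1 fiso hX Bconv sB s'B Bz Bw).
    by rewrite -e zz'.
  by apply/seteqP; split=> _ [u Wu <-]; exists u => //=; rewrite ss'//; have [] := WB _ Wu.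
- move=> _ [s sB ->]; split.
    by apply: (section_image_open fC1 fiso oW) => z Wz; [exact: fsec|exact: csec].
  split.
    apply/seteqP; split=> [_ [_ [z Wz <-] <-]|z Wz]; first by rewrite /= fsec.
    by exists (s (q z)); [exists z|exact: fsec].
  split.
    have [fc fd] := fC1; split=> [x _|p p' pM p'M]; first exact: fc.
    move=> _ [x [[_ px] p'x] <-]; apply: (fd p p' pM p'M).
    by exists x.
  exists (s \o q); split; first by move=> _ [z Wz <-]; rewrite /= fsec.
  by apply: (section_C1 fC1 fiso) => // z Wz; [exact: fsec|exact: csec].
Qed.

Lemma covering_onto : connected [set: Y] -> range f = setT.
Proof.
move=> cY.
(* One point of [V] in the image yields one sheet over [V], which maps onto all of [V]. This gives
   openness of the image and, by contraposition, of its complement. *)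
have full y V D : f @^-1` V = \bigcup_(U in D) U ->
    (forall U, D U -> open U /\ diffeo_onto MX MY f U V) ->
    (range f) y -> V y -> V `<=` range f.
  move=> fV DV [x _ <-] Vx z Vz.
  have : (f @^-1` V) x by [].
  rewrite fV => -[U DU _]; have [_ [fU _]] := DV _ DU.
  by move: Vz; rewrite -fU => -[x' _ <-]; exists x'.
apply: cY.
- by have [x _] := manifold_nonempty MX; exists (f x), x.
- exists (range f); rewrite ?setTI// openE => y fy.
  have [V [oV Vy [D [fV _ DV]]]] := evenly_covered y.
  apply: filterS (open_nbhs_nbhs (conj oV Vy)); exact: full fV DV fy Vy.
exists (range f); rewrite ?setTI// -openC openE => y nfy.
have [V [oV Vy [D [fV _ DV]]]] := evenly_covered y.
apply: filterS (open_nbhs_nbhs (conj oV Vy)) => z Vz fz.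
exact: nfy (full z V D fV DV fz Vz y Vy).
Qed.

End EvenCovering.

Theorem theorem14 (R : realType) (E F : completeNormedModType R)
    (X Y : topologicalType) (MX : manifold E X) (MY : manifold F Y)
    (NX : finsler MX) (NY : finsler MY) (f : X -> Y) (mu : X -> \bar R) :
  connected [set: Y] ->
  C1_fredholm0 MX MY f ->
  mu = Inj_diff NX NY f \/ mu = Sur_diff NX NY f ->
  earle_eells NX f mu ->
  smooth_covering MX MY f.
Proof.
move=> cY fred muE ee; have exf := earle_eells_expansive fred muE ee.
have [cX _] := ee; split; first by have [] := fred.
  exact: covering_onto fred exf cX cY.
exact: evenly_covered fred exf cX.
Qed.
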